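(* Suppose we are given a rational, primal and dual feasible LP $\min\{c^Tx \mid Ax=b,\ x\ge\ell\}$ and a limited-precision LP-basis oracle (which does not report failure on the calls made). Then the Iterative Refinement algorithm interleaved with a basis verification step (defined in the context) terminates with an optimal solution to the LP in oracle-polynomial running time, i.e., with a number of oracle calls and a number of bit operations that are polynomial in the size of $A,b,\ell,c$.
   Context: All logarithms are base two. Encoding length (size): $\langle z\rangle := 1+\lceil\log(|z|+1)\rceil$ for $z\in\mathbb{Z}$; $\langle r/q\rangle:=\langle r\rangle+\langle q\rangle$ for a rational number $r/q$ in lowest terms with $q>0$; the size of a vector or matrix is the sum of the sizes of its entries; the size of several objects is the sum of their sizes. $\|\cdot\|_\infty$ is the maximum norm and $\mathbb{1}$ the all-ones vector. The LP is $\min\{c^T x \mid Ax=b,\ x\ge\ell\}$ with $A\in\mathbb{Q}^{m\times n}$ of full row rank, $m\le n$, $b\in\mathbb{Q}^m$, $c,\ell\in\mathbb{Q}^n$. A basis is a set $\mathcal{B}\subseteq\{1,\ldots,n\}$ of $m$ indices such that the columns $A_{\cdot i}$, $i\in\mathcal{B}$, are linearly independent; $A_{\cdot\mathcal{B}}$ is the matrix of these columns. Its basic primal-dual solution $\tilde x,\tilde y$ is given by $\tilde x_i=\ell_i$ for $i\notin\mathcal{B}$, $\tilde x_{\mathcal{B}}=A_{\cdot\mathcal{B}}^{-1}(b-\sum_{i\notin\mathcal{B}}A_{\cdot i}\ell_i)$, and $A_{\cdot\mathcal{B}}^T\tilde y=c_{\mathcal{B}}$. Primal feasible: $Ax=b$,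 $x\ge\ell$. Dual feasible: $c-A^Ty\ge0$. Let $\mathbb{F}(p):=\{n/2^p\in\mathbb{Q} : n\in\mathbb{Z},\ |n|\le 2^{2p}\}$. A limited-precision LP-basis oracle is an oracle for which there exist constants $p\in\mathbb{N}$, $0<\eta<1$, $\sigma>0$ such that for any LP $\min\{c^Tx : Ax=b,\ x\ge\ell\}$ with rational data, when given the LP obtained by rounding all numbers in $A,b,\ell,c$ to $\mathbb{F}(p)$, it either reports a ''failure'' or returns $\bar x\in\mathbb{F}(p)^n$, $\bar y\in\mathbb{F}(p)^m$ and a basis $\mathcal{B}$ satisfying, with respect to the unrounded data, $\|A\bar x-b\|_\infty\le\eta$, $\bar x\ge\ell-\eta\mathbb{1}$, $c-A^T\bar y\ge-\eta\mathbb{1}$, $|(\bar x-\ell)^T(c-A^T\bar y)|\le\sigma$, $|\bar x_i-\ell_i|\le\eta$ for all $i\notin\mathcal{B}$, and $|c_i-\bar y^TA_{\cdot i}|\le\eta$ for all $i\in\mathcal{B}$. ''Calling the oracle for'' an LP means passing it the rounded LP. The oracle constants $p,\eta,\sigma$ and the algorithm parameter $\alpha$ are regarded as fixed. Iterative Refinement algorithm interleaved with basis verification. Parameter: incremental scaling limit $\alpha\in\mathbb{N}$, $\alpha\ge2$; termination tolerance $0$. Set $\Delta_1:=1$. Call the oracle for $\min\{c^Tx: Ax=b,\ x\ge\ell\}$, aborting on failure; let $(x_1,y_1)$ and $\mathcal{B}_1$ be the returned solution and basis. For $k=1,2,\ldots$: (i) compute $\hat b:=b-Ax_k$, $\hat\ell:=\ell-x_k$,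 $\hat c:=c-A^Ty_k$; (ii) compute $\delta_k:=\max\{\max_j|\hat b_j|,\ \max_i\hat\ell_i,\ \max_i(-\hat c_i),\ |\sum_i-\hat\ell_i\hat c_i|\}$; if $\delta_k\le0$, return $(x_k,y_k)$; (basis verification) solve exactly over the rationals, by a polynomial-time method, the linear systems giving the basic primal-dual solution $\tilde x,\tilde y$ of $\mathcal{B}_k$; if $\tilde x$ is primal feasible and $\tilde y$ is dual feasible, return $(\tilde x,\tilde y)$ as optimal solution, otherwise discard it; (iii) replace $\delta_k$ by $\max\{\delta_k,\,1/(\alpha\Delta_k)\}$ and set $\Delta_{k+1}:=2^{\lceil\log(1/\delta_k)\rceil}$; (iv) call the oracle for $\min\{(\Delta_{k+1}\hat c)^Tx : Ax=\Delta_{k+1}\hat b,\ x\ge\Delta_{k+1}\hat\ell\}$, aborting on failure; let $(\hat x,\hat y)$ and $\mathcal{B}_{k+1}$ be the returned solution and basis; (v) set $(x_{k+1},y_{k+1}):=(x_k,y_k)+\frac{1}{\Delta_{k+1}}(\hat x,\hat y)$. Exact rational arithmetic is used outside the oracle.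
   Formalization: The oracle constant σ is additionally assumed to be less than 1; with only σ > 0 the claim fails, since the complementary slackness term in δ_k may stay at least 1, so the scaling factor never grows and the algorithm can loop forever. *)

(* Defs.v *)
From HB Require Import structures.
From mathcomp Require Import all_boot all_order all_algebra reals.

Set Implicit Arguments.
Unset Strict Implicit.
Unset Printing Implicit Defensive.

Import Order.TTheory GRing.Theory Num.Theory.
Local Open Scope ring_scope.

(* [up_log 2 k] is the ceiling of log2 k for k >= 1. *)
Definition int_size (z : int) : nat := (up_log 2 (`|z|%N.+1)).+1.
Definition rat_size (q : rat) : nat := (int_size (numq q) + int_size (denq q))%N.
Definition mx_size (m n : nat) (M : 'M[rat]_(m, n)) : nat :=
  (\sum_(i < m) \sum_(j < n) rat_size (M i j))%N.

(* min c^T x  subject to  A x = b, x >= l *)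
Record lp (m n : nat) := LP {
  lpA : 'M[rat]_(m, n); lpb : 'cV[rat]_m; lpl : 'cV[rat]_n; lpc : 'cV[rat]_n }.

Definition lp_size m n (L : lp m n) : nat :=
  (mx_size (lpA L) + mx_size (lpb L) + mx_size (lpl L) + mx_size (lpc L))%N.

Definition reduced_cost m n (L : lp m n) (y : 'cV[rat]_m) : 'cV[rat]_n :=
  lpc L - (lpA L)^T *m y.

Definition primal_feasible m n (L : lp m n) (x : 'cV[rat]_n) : Prop :=
  lpA L *m x = lpb L /\ forall i, lpl L i 0 <= x i 0.

Definition dual_feasible m n (L : lp m n) (y : 'cV[rat]_m) : Prop :=
  forall i, 0 <= reduced_cost L y i 0.

Definition primal_value m n (L : lp m n) (x : 'cV[rat]_n) : rat :=
  ((lpc L)^T *m x) 0 0.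

Definition dual_value m n (L : lp m n) (y : 'cV[rat]_m) : rat :=
  ((lpb L)^T *m y + (lpl L)^T *m reduced_cost L y) 0 0.

(* The algorithm returns a primal-dual pair; both components are optimal. *)
Definition optimal_pair m n (L : lp m n) (x : 'cV[rat]_n) (y : 'cV[rat]_m) : Prop :=
  [/\ primal_feasible L x,
      forall x', primal_feasible L x' -> primal_value L x <= primal_value L x',
      dual_feasible L y &
      forall y', dual_feasible L y' -> dual_value L y' <= dual_value L y].

(* A_{.B}, the columns being listed in the order of [enum B]. *)
Definition basis_cols m n (A : 'M[rat]_(m, n)) (B : {set 'I_n}) : 'M[rat]_(m, #|B|) :=
  \matrix_(i, j) A i (enum_val j).

Definition is_basis m n (A : 'M[rat]_(m, n)) (B : {set 'I_n}) : Prop :=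
  #|B| = m /\ row_free (basis_cols A B)^T.

Definition in_fixed (p : nat) (q : rat) : Prop :=
  exists2 z : int, `|z| <= (2 ^ (2 * p))%N%:Z & q = z%:~R / 2 ^+ p.

(* Rounding to a nearest number satisfying [in_fixed p]: ties go up, and numbers outside the
   range [-2^p, 2^p] go to its nearest end. *)
Definition round_fixed (p : nat) (q : rat) : rat :=
  Num.max (- 2 ^+ p) (Num.min (2 ^+ p) ((Num.floor (q * 2 ^+ p + 2^-1))%:~R / 2 ^+ p)).

Definition round_lp (p : nat) m n (L : lp m n) : lp m n :=
  LP (map_mx (round_fixed p) (lpA L)) (map_mx (round_fixed p) (lpb L))
     (map_mx (round_fixed p) (lpl L)) (map_mx (round_fixed p) (lpc L)).

Record answer (m n : nat) := Answer {
  ansx : 'cV[rat]_n; ansy : 'cV[rat]_m; ansB : {set 'I_n} }.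

Definition ans_size m n (a : answer m n) : nat :=
  (mx_size (ansx a) + mx_size (ansy a) + n)%N.

(* The oracle sees only the LP it is passed; [None] is a reported failure. *)
Definition lp_oracle := forall m n : nat, lp m n -> option (answer m n).

Record good_answer (R : realType) (p : nat) (eta sigma : R) m n (L : lp m n)
    (a : answer m n) : Prop := GoodAnswer {
  ga_x_fixed : forall i, in_fixed p (ansx a i 0);
  ga_y_fixed : forall j, in_fixed p (ansy a j 0);
  ga_basis : is_basis (lpA L) (ansB a);
  ga_eq : forall j, ratr `|(lpA L *m ansx a - lpb L) j 0| <= eta;
  ga_lb : forall i, ratr (lpl L i 0) - eta <= ratr (ansx a i 0);
  ga_dual : forall i, - eta <= ratr (reduced_cost L (ansy a) i 0);
  ga_slack :
    ratr `|((ansx a - lpl L)^T *m reduced_cost L (ansy a)) 0 0| <= sigma;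
  ga_nonbasic :
    forall i, i \notin ansB a -> ratr `|ansx a i 0 - lpl L i 0| <= eta;
  ga_basic :
    forall i, i \in ansB a -> ratr `|reduced_cost L (ansy a) i 0| <= eta }.

(* The guarantee concerns every unrounded LP [L] satisfying the standing
   assumption of full row rank, and only the rounding of [L] is passed.

   The bound sigma should be less than 1 when the oracle is used for iterative
   refinement.  Since the violation [d] measured below includes the absolute
   value of the complementary slackness, which the oracle only bounds by sigma,
   1 / d may be at most 1 if sigma is not less than 1; the scaling factor then
   need not increase and the refinement may never end, as with
     min x1/4 + 3 x2/4,  x1 + x2 = 0,  x1 >= 0,  x2 >= -2,
   p = 2, eta = 7/8 and sigma = 2 when x = 0, y = 0 and the suboptimal basis
   {2} are returned by every call. *)
Definition limited_precision_basis_oracle (R : realType) (p : nat) (eta sigma : R)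
    (O : lp_oracle) : Prop :=
  forall m n (L : lp m n), row_free (lpA L) ->
    forall a, O m n (round_lp p L) = Some a -> good_answer p eta sigma L a.

(* Ceiling of log2 r, for r > 0. *)
Definition ceil_log2 (r : rat) : int :=
  if 1 <= r then (up_log 2 `|Num.ceil r|%N)%:Z
  else - (trunc_log 2 `|Num.floor r^-1|%N)%:Z.

Definition pow2_ceil (r : rat) : rat := 2 ^ ceil_log2 r.

Lemma ceil_log2P (r : rat) : 0 < r -> 2 ^ (ceil_log2 r - 1) < r <= 2 ^ ceil_log2 r.
Proof.
move=> r0.
rewrite /ceil_log2; case: (leP 1 r) => [r1|r1].
  have c1 : 1 <= Num.ceil r by rewrite -(ler_int rat) (le_trans r1) ?ceil_ge.
  case E : (Num.ceil r) c1 => [k|k] // k1; rewrite absz_nat.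
  have rk : r <= k%:R by have := ceil_ge r; rewrite E.
  have kr : k%:R - 1 < r.
    by have /andP[+ _] := ceil_itv r; rewrite E intrB.
  apply/andP; split; last first.
    by rewrite (le_trans rk) // -exprnP -natrX ler_nat up_logP.
  case: (leqP k 1) => [k1'|k2].
    have -> : up_log 2 k = 0%N by apply/eqP; rewrite up_log_eq0 k1'.
    by rewrite (lt_le_trans _ r1).
  have /andP[lo _] := up_log_bounds (isT : 1 < 2)%N k2.
  have u0 : (0 < up_log 2 k)%N by rewrite up_log_gt0.
  have -> : (up_log 2 k)%:Z - 1 = ((up_log 2 k).-1)%:Z.
    by rewrite -[in LHS](prednK u0) -(addn1 (up_log 2 k).-1) PoszD addrK.
  rewrite -exprnP -natrX (le_lt_trans _ kr) //.
  by rewrite lerBrDr natr1 ler_nat.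
have ri1 : 1 < r^-1 by rewrite invf_gt1.
have /andP[fl fu] := floor_itv r^-1.
have f1 : 1 <= Num.floor r^-1 by rewrite -ltzD1 -(ltr_int rat) (lt_trans ri1).
case E : (Num.floor r^-1) f1 fl fu => [k|k] // k1 fl fu; rewrite absz_nat.
have /andP[lo hi] := trunc_log_bounds (isT : 1 < 2)%N (k1 : 0 < k)%N.
have -> : - (trunc_log 2 k)%:Z - 1 = - ((trunc_log 2 k).+1)%:Z.
  by rewrite -(addn1 (trunc_log 2 k)) PoszD opprD.
rewrite -!exprz_inv -!exprnP !exprVn; apply/andP; split.
  rewrite invf_plt ?posrE ?exprn_gt0 // (lt_le_trans fu) // -natrX.
  by rewrite intrD natr1 ler_nat.
by rewrite -[leLHS]invrK lef_pV2 ?posrE ?invr_gt0 ?exprn_gt0 // (le_trans _ fl) // -natrX ler_nat.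
Qed.

(* Bit complexity.  The elementary operations are those on single rational
   numbers; the number of bit operations that each of them takes on given
   operands is a parameter, required below only to be polynomial in the sizes
   of the operands. *)
Inductive unop := Move | Neg | Abs | Round of nat | Pow2Ceil.
Inductive binop := Add | Sub | Mul | Div | Cmp.

Record bit_cost := BitCost {
  cost1 : unop -> rat -> nat;
  cost2 : binop -> rat -> rat -> nat }.

Definition polynomial_bit_cost (C : bit_cost) : Prop :=
  (forall o, exists P : {poly nat}, forall x, (cost1 C o x <= P.[rat_size x])%N) /\
  (forall o, exists P : {poly nat}, forall x y,
     (cost2 C o x y <= P.[rat_size x + rat_size y])%N).

(* A method for nonsingular linear systems, returning the solution together
   with the number of bit operations spent.  The number k of columns is kept
   separate from the number m of rows because the matrices A_{.B} have #|B|
   columns; [row_free] and [row_full] together say that M is square and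
   nonsingular. *)
Definition lin_solver := forall m k : nat, 'M[rat]_(m, k) -> 'cV[rat]_m -> 'cV[rat]_k * nat.

Definition polynomial_time_solver (S : lin_solver) : Prop :=
  (forall m k (M : 'M[rat]_(m, k)) (r : 'cV[rat]_m),
     row_free M -> row_full M -> M *m (S m k M r).1 = r) /\
  exists P : {poly nat}, forall m k (M : 'M[rat]_(m, k)) (r : 'cV[rat]_m),
     row_free M -> row_full M -> ((S m k M r).2 <= P.[mx_size M + mx_size r])%N.

(* A value together with the numbers of oracle calls and of bit operations
   spent on computing it. *)
Record timed (T : Type) := Timed { val_of : T; calls_of : nat; bits_of : nat }.

Definition tret T (x : T) : timed T := Timed x 0 0.

Definition tbind T U (a : timed T) (f : T -> timed U) : timed U :=
  let b := f (val_of a) in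
  Timed (val_of b) (calls_of a + calls_of b) (bits_of a + bits_of b).

Notation "'let!' x := a 'in' f" := (tbind a (fun x => f))
  (at level 200, x name, a at level 100, f at level 200,
   format "'[v' 'let!'  x  :=  a  'in' '/' f ']'").

Definition tcol n (f : 'I_n -> timed rat) : timed 'cV[rat]_n :=
  Timed (\col_i val_of (f i)) (\sum_(i < n) calls_of (f i)) (\sum_(i < n) bits_of (f i)).

Definition tmat m n (f : 'I_m -> 'I_n -> timed rat) : timed 'M[rat]_(m, n) :=
  Timed (\matrix_(i, j) val_of (f i j)) (\sum_(i < m) \sum_(j < n) calls_of (f i j))
        (\sum_(i < m) \sum_(j < n) bits_of (f i j)).

Definition tforall n (f : 'I_n -> timed bool) : timed bool :=
  Timed [forall i, val_of (f i)] (\sum_(i < n) calls_of (f i)) (\sum_(i < n) bits_of (f i)).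

Definition tfold T n (f : T -> 'I_n -> timed T) (s0 : T) : timed T :=
  foldl (fun acc i => let! s := acc in f s i) (tret s0) (enum 'I_n).

Section Algorithm.

Variables (C : bit_cost) (S : lin_solver) (p alpha : nat) (O : lp_oracle).

Definition tmove x := Timed x 0 (cost1 C Move x).
Definition tneg x := Timed (- x) 0 (cost1 C Neg x).
Definition tabs x := Timed `|x| 0 (cost1 C Abs x).
Definition tround x := Timed (round_fixed p x) 0 (cost1 C (Round p) x).
Definition tpow2 x := Timed (pow2_ceil x) 0 (cost1 C Pow2Ceil x).
Definition tadd x y := Timed (x + y) 0 (cost2 C Add x y).
Definition tsub x y := Timed (x - y) 0 (cost2 C Sub x y).
Definition tmul x y := Timed (x * y) 0 (cost2 C Mul x y).
Definition tdiv x y := Timed (x / y) 0 (cost2 C Div x y).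
Definition tle x y := Timed (x <= y) 0 (cost2 C Cmp x y).
Definition teq x y := Timed (x == y) 0 (cost2 C Cmp x y).
Definition tmax x y := Timed (Num.max x y) 0 (cost2 C Cmp x y).

(* s0 - sum_i u_i v_i, with partial sums formed from left to right *)
Definition tsubdot n (s0 : rat) (u v : 'I_n -> rat) : timed rat :=
  tfold (fun s i => let! t := tmul (u i) (v i) in tsub s t) s0.

Definition tsolve m k (M : 'M[rat]_(m, k)) (r : 'cV[rat]_m) : timed 'cV[rat]_k :=
  Timed (S M r).1 0 (S M r).2.

(* Besides the rounding, a call is charged for writing the query and for
   reading the answer. *)
Definition tcall m n (L : lp m n) : timed (option (answer m n)) :=
  let! A := tmat (fun i j => tround (lpA L i j)) in
  let! b := tcol (fun j => tround (lpb L j 0)) in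
  let! l := tcol (fun i => tround (lpl L i 0)) in
  let! c := tcol (fun i => tround (lpc L i 0)) in
  let Q := LP A b l c in
  Timed (O Q) 1 (lp_size Q + (if O Q is Some a then ans_size a else 1))%N.

Section Run.

Variables (m n : nat) (L : lp m n).
Let A := lpA L.

(* The current solution, the basis returned with it, and the scaling factor. *)
Record state := State {
  st_x : 'cV[rat]_n; st_y : 'cV[rat]_m; st_B : {set 'I_n}; st_D : rat }.

Inductive outcome :=
  | Running of state
  | Returned of 'cV[rat]_n & 'cV[rat]_m
  | Aborted.

Definition tprimal_residual (x : 'cV[rat]_n) : timed 'cV[rat]_m :=
  tcol (fun j => tsubdot (lpb L j 0) (fun i => A j i) (fun i => x i 0)).

Definition tdual_residual (y : 'cV[rat]_m) : timed 'cV[rat]_n :=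
  tcol (fun i => tsubdot (lpc L i 0) (fun j => A j i) (fun j => y j 0)).

(* max { max_j |bh_j|, max_i lh_i, max_i (- ch_i), |sum_i - lh_i ch_i| } *)
Definition tviolation (bh : 'cV[rat]_m) (lh ch : 'cV[rat]_n) : timed rat :=
  let! s := tsubdot 0 (fun i => lh i 0) (fun i => ch i 0) in
  let! d0 := tabs s in
  let! d1 := tfold (fun d j => let! t := tabs (bh j 0) in tmax d t) d0 in
  let! d2 := tfold (fun d i => tmax d (lh i 0)) d1 in
  tfold (fun d i => let! t := tneg (ch i 0) in tmax d t) d2.

(* In [tbasic_primal], the system is solved for the entries in B, which
   [pick] then distributes to their positions. *)
Definition tbasic_primal (B : {set 'I_n}) : timed 'cV[rat]_n :=
  let! r := tcol (fun j => tfold (fun s i =>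
              if i \in B then tret s
              else let! t := tmul (A j i) (lpl L i 0) in tsub s t) (lpb L j 0)) in
  let! M := tmat (fun j (k : 'I_#|B|) => tmove (A j (enum_val k))) in
  let! z := tsolve M r in
  tcol (fun i => if [pick k : 'I_#|B| | enum_val k == i] is Some k
                 then tmove (z k 0) else tmove (lpl L i 0)).

Definition tbasic_dual (B : {set 'I_n}) : timed 'cV[rat]_m :=
  let! M := tmat (fun (k : 'I_#|B|) j => tmove (A j (enum_val k))) in
  let! r := tcol (fun k : 'I_#|B| => tmove (lpc L (enum_val k) 0)) in
  tsolve M r.

Definition tprimal_feasible (x : 'cV[rat]_n) : timed bool :=
  let! r := tprimal_residual x in
  let! eqs := tforall (fun j => teq (r j 0) 0) in
  let! lbs := tforall (fun i => tle (lpl L i 0) (x i 0)) in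
  tret (eqs && lbs).

Definition tdual_feasible (y : 'cV[rat]_m) : timed bool :=
  let! r := tdual_residual y in
  tforall (fun i => tle 0 (r i 0)).

Definition ir_start : timed outcome :=
  let! a := tcall L in
  tret (if a is Some a then Running (State (ansx a) (ansy a) (ansB a) 1) else Aborted).

Definition ir_refine (s : state) (bh : 'cV[rat]_m) (lh ch : 'cV[rat]_n) (d : rat) :
    timed outcome :=
  let! aD := tmul alpha%:R (st_D s) in
  let! e := tdiv 1 aD in
  let! d' := tmax d e in
  let! q := tdiv 1 d' in
  let! D := tpow2 q in
  let! b := tcol (fun j => tmul D (bh j 0)) in
  let! l := tcol (fun i => tmul D (lh i 0)) in
  let! c := tcol (fun i => tmul D (ch i 0)) in
  let! a := tcall (LP A b l c) in
  if a is Some a then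
    let! x := tcol (fun i => let! t := tdiv (ansx a i 0) D in tadd (st_x s i 0) t) in
    let! y := tcol (fun j => let! t := tdiv (ansy a j 0) D in tadd (st_y s j 0) t) in
    tret (Running (State x y (ansB a) D))
  else tret Aborted.

Definition ir_iterate (s : state) : timed outcome :=
  let! bh := tprimal_residual (st_x s) in
  let! lh := tcol (fun i => tsub (lpl L i 0) (st_x s i 0)) in
  let! ch := tdual_residual (st_y s) in
  let! d := tviolation bh lh ch in
  let! stop := tle d 0 in
  if stop then tret (Returned (st_x s) (st_y s)) else
  let! x := tbasic_primal (st_B s) in
  let! y := tbasic_dual (st_B s) in
  let! px := tprimal_feasible x in
  let! dy := tdual_feasible y in
  if px && dy then tret (Returned x y) else
  ir_refine s bh lh ch d.

(* The initial call followed by at most N iterations *)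
Fixpoint ir_run (N : nat) : timed outcome :=
  if N is N'.+1 then
    let! o := ir_run N' in
    if o is Running s then ir_iterate s else tret o
  else ir_start.

End Run.
End Algorithm.

(* Main.v *)
(* Since eta and sigma are below 1, each refinement shrinks the violation below
   1/D, and the scaling factor D, a power of two, at least doubles: it is 2^e
   with e >= N after N refinements, while the limit alpha on its growth keeps e
   at most N alpha.  The basic solutions of the returned basis differ from the
   current iterates by at most 2^k / D, with k polynomial in the input size by
   Cramer's rule.  Their slacks and reduced costs are rationals whose
   denominators are bounded in the same way, so once e exceeds a polynomial
   bound no negative one is left and the basis is verified; complementary
   slackness then gives optimality.  Up to that point every number computed has
   polynomial size: the iterates are sums of numbers of F(p) divided by
   increasing powers of two, so their denominators do not accumulate. *)

Require Import Defs.
From mathcomp Require Import all_boot all_order all_fingroup all_algebra reals.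
From mathcomp Require Import zify ring lra.

Set Implicit Arguments.
Unset Strict Implicit.
Unset Printing Implicit Defensive.

Import Order.TTheory GRing.Theory Num.Theory.
Local Open Scope ring_scope.

(** The threshold on e must depend on the input alone, although the iterates grow with e. Two size
    parameters therefore run side by side. Basic solutions are computed from the original data, so
    their heights are bounded in terms of [lp_size]; only the residuals and the scaled problems see
    the larger heights of the iterates, and these are controlled once the number of iterations is.
    The polynomial has to be chosen before the LP and the oracle. Each cost is therefore an explicit
    function of one bound T on dimensions and heights, and each piece of the program gets a triple
    bounding calls and bits together with a specification of its result. The real constants eta and
    sigma enter only as numbers below 1, which turn the guarantee of the oracle into strict rational
    inequalities; this strictness is what forces the exponent e to grow. *)

(** * Heights of rational numbers *)

(* Heights measure size as [rat_size] does up to constant factors, but they add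
   up under all field operations (plus one for sums), so that a sum of n terms
   has a height linear in n. *)
Definition height (N : nat) (q : rat) : bool :=
  (`|numq q| <= 2 ^ N)%N && (`|denq q| <= 2 ^ N)%N.

(** Reduction to lowest terms divides a and d by a common factor, so bounds on any representation as
    a fraction suffice. *)
Lemma height_frac N (a d : int) : d != 0 -> (`|a| <= 2 ^ N)%N -> (`|d| <= 2 ^ N)%N ->
  height N (a%:~R / d%:~R).
Proof.
move=> d0 aN dN; move: d0 aN dN; case: divqP => [n //|k x k0 _].
rewrite !abszM => aN dN; have k1 : (0 < `|k|)%N by rewrite absz_gt0.
by apply/andP; split; [apply: leq_trans aN|apply: leq_trans dN]; rewrite leq_pmull.
Qed.

Lemma height_fracE N q : height N q ->
  exists a d : int, [/\ d != 0, (`|a| <= 2 ^ N)%N, (`|d| <= 2 ^ N)%N & q = a%:~R / d%:~R].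
Proof.
case/andP=> qn qd; exists (numq q), (denq q); split=> //.
by rewrite divq_num_den.
Qed.

Lemma height_mono M N q : (M <= N)%N -> height M q -> height N q.
Proof.
move=> MN /andP[qn qd].
by rewrite /height (leq_trans qn) ?(leq_trans qd) ?leq_pexp2l.
Qed.

Lemma height_int N (z : int) : (`|z| <= 2 ^ N)%N -> height N z%:~R.
Proof. by move=> zN; rewrite -[_%:~R]divr1; apply: (@height_frac _ z 1); rewrite ?expn_gt0. Qed.

Lemma height_nat N (k : nat) : (k <= 2 ^ N)%N -> height N k%:R.
Proof. exact: (@height_int N k). Qed.

Lemma height0 N : height N 0. Proof. exact: (@height_nat N 0). Qed.

Lemma height1 N : height N 1. Proof. by apply: (@height_nat N 1); rewrite expn_gt0. Qed.

Lemma heightN N q : height N (- q) = height N q.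
Proof. by rewrite /height numqN denqN abszN. Qed.

Lemma heightD M N x y : height M x -> height N y -> height (M + N).+1 (x + y).
Proof.
case/height_fracE=> a [d [d0 aM dM ->]] /height_fracE[b [e [e0 bN eN ->]]].
rewrite addf_div ?intr_eq0 // -!intrM -intrD.
apply: height_frac; first by rewrite mulf_neq0.
  suff: (absz (a * e)%R + absz (b * d)%R <= 2 ^ (M + N).+1)%N by lia.
  rewrite !abszM expnS expnD mul2n -addnn.
  by apply: leq_add; [|rewrite mulnC]; apply: leq_mul.
by rewrite abszM (leq_trans (leq_mul dM eN)) // -expnD leq_pexp2l.
Qed.

Lemma heightB M N x y : height M x -> height N y -> height (M + N).+1 (x - y).
Proof. by move=> xM yN; apply: heightD => //; rewrite heightN. Qed.

Lemma heightM M N x y : height M x -> height N y -> height (M + N) (x * y).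
Proof.
case/height_fracE=> a [d [d0 aM dM ->]] /height_fracE[b [e [e0 bN eN ->]]].
rewrite mulf_div -!intrM; apply: height_frac; first by rewrite mulf_neq0.
  by rewrite abszM expnD leq_mul.
by rewrite abszM expnD leq_mul.
Qed.

Lemma heightV N x : height N x -> height N x^-1.
Proof.
have [->|x0] := eqVneq x 0; first by rewrite invr0.
case/height_fracE=> a [d [d0 aN dN xE]]; rewrite xE invf_div; apply: height_frac => //.
by apply: contra_neq x0 => a0; rewrite xE a0 mul0r.
Qed.

Lemma height_div M N x y : height M x -> height N y -> height (M + N) (x / y).
Proof. by move=> xM yN; apply: heightM => //; apply: heightV. Qed.

Lemma height_norm N x : height N x -> height N `|x|.
Proof. by case: (ger0P x) => // _; rewrite heightN. Qed.

Lemma height_max N x y : height N x -> height N y -> height N (Num.max x y).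
Proof. by rewrite /Num.max; case: ifP. Qed.

Lemma height_le N x : height N x -> `|x| <= 2 ^+ N.
Proof.
case/height_fracE=> a [d [d0 aN dN ->]].
rewrite normrM normfV ler_pdivrMr ?normr_gt0 ?intr_eq0 //.
rewrite (@le_trans _ _ (2 ^+ N * 1)) //; last first.
  by rewrite ler_wpM2l ?exprn_ge0 // -intr_norm ler1z -gtz0_ge1 normr_gt0.
by rewrite mulr1 -intr_norm -abszE -natrX -[_%:~R]/(_%:R) ler_nat.
Qed.

(** The inverse of x has height N as well, hence is at most 2^N. This gap above 0 is what later
    turns smallness into a sign. *)
Lemma height_gap N x : height N x -> 0 < x -> 2 ^- N <= x.
Proof.
move=> xN x0; rewrite -[leRHS]invrK lef_pV2 ?posrE ?invr_gt0 ?exprn_gt0 //.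
by rewrite (le_trans (ler_norm _)) // height_le // heightV.
Qed.

(** Clamping to absolute value 2^p at denominator 2^p leaves numerators up to 2^(2p), whatever the
    height of q. *)
Lemma height_round p q : height (2 * p) (round_fixed p q).
Proof.
have h2p : height (2 * p) (2 ^+ p).
  by rewrite -natrX; apply: height_nat; rewrite leq_pexp2l // leq_pmull.
have p0 : (0 : rat) < 2 ^+ p by rewrite exprn_gt0.
rewrite /round_fixed; set f := Num.floor _.
case: (leP (2 ^+ p)) => [_|flt]; first by apply: height_max; rewrite ?heightN.
case: (ltP (- 2 ^+ p)) => [fgt|_]; last by rewrite heightN.
have fE : (`|f| <= 2 ^ (2 * p))%N.
  rewrite -(ler_nat rat) natrX mul2n -addnn exprD -ler_pdivrMr //.
  rewrite -[`|f|%:R]/((`|f|%N)%:Z%:~R) abszE intr_norm -[X in _ / X](ger0_norm (ltW p0)).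
  by rewrite -normf_div ler_norml !ltW.
rewrite -[X in _ / X]natrX; apply: (@height_frac _ f (2 ^ p)%N) => //.
  by rewrite -lt0n expn_gt0.
by rewrite leq_pexp2l // leq_pmull.
Qed.

(** * Heights compared with encoding sizes *)

Lemma leq_sum_ord n (F : 'I_n -> nat) b :
  (forall i, (F i <= b)%N) -> (\sum_(i < n) F i <= n * b)%N.
Proof.
by move=> Fb; rewrite -[n in leqRHS]card_ord -sum_nat_const leq_sum.
Qed.

Lemma int_size_le N (z : int) : (`|z| <= 2 ^ N)%N -> (int_size z <= N + 2)%N.
Proof.
move=> zN; rewrite /int_size addn2 ltnS; apply: up_log_min => //.
by have := expn_gt0 2 N; rewrite expnS /=; lia.
Qed.

Lemma rat_size_le N q : height N q -> (rat_size q <= 2 * N + 4)%N.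
Proof.
by case/andP=> /int_size_le nN /int_size_le dN; have := leq_add nN dN; rewrite /rat_size; lia.
Qed.

Lemma height_rat_size q : height (rat_size q) q.
Proof.
have szP (z : int) : (`|z| <= 2 ^ int_size z)%N.
  rewrite (leq_trans (leqnSn _)) // (leq_trans (up_logP _ (isT : 1 < 2)%N)) //.
  by rewrite leq_pexp2l // leqnSn.
apply/andP; split; rewrite (leq_trans (szP _)) // leq_pexp2l //.
  exact: leq_addr.
exact: leq_addl.
Qed.

Lemma mx_size_le N m n (M : 'M[rat]_(m, n)) :
  (forall i j, height N (M i j)) -> (mx_size M <= m * (n * (2 * N + 4)))%N.
Proof.
by move=> MN; do 2!apply: leq_sum_ord => ?; apply: rat_size_le.
Qed.

Lemma rat_size_entry m n (M : 'M[rat]_(m, n)) i j : (rat_size (M i j) <= mx_size M)%N.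
Proof.
by rewrite /mx_size (bigD1 i) //= (bigD1 j) //= -addnA leq_addr.
Qed.

Lemma mx_size_ge m n (M : 'M[rat]_(m, n)) : (m * n <= mx_size M)%N.
Proof.
rewrite -[X in (X * n)%N]card_ord -sum_nat_const leq_sum // => i _.
by rewrite -[n in leqLHS]card_ord -sum1_card leq_sum.
Qed.

(** * Size of solutions of linear systems *)

(** The Leibniz formula has k! terms, each a signed product of k entries. *)
Lemma absdet_le k (M : 'M[int]_k) (B : nat) :
  (forall i j, `|M i j| <= B%:Z) -> `|\det M| <= (k`! * B ^ k)%N%:Z.
Proof.
move=> MB; rewrite (le_trans (ler_norm_sum _ _ _)) //.
rewrite (@le_trans _ _ (\sum_(s : 'S_k) (B ^ k)%N%:Z)) //.
  apply: ler_sum => s _; rewrite normrM normr_sign mul1r normr_prod.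
  rewrite (@le_trans _ _ (\prod_(i < k) B%:Z)) //.
    by apply: ler_prod => i _; rewrite normr_ge0 MB.
  by rewrite prodr_const card_ord -!natz natrX.
rewrite sumr_const (_ : #|_| = k`!); last first.
  by rewrite -card_Sn; apply: eq_card => s; rewrite !inE.
by rewrite PoszM mulrC -mulr_natr natz.
Qed.

(** The integer E q, provided that the denominator of q divides E. *)
Definition scaled (E : nat) (q : rat) : int := numq q * (E %/ `|denq q|)%N%:Z.

Lemma scaledE E q : (`|denq q| %| E)%N -> (scaled E q)%:~R = E%:R * q :> rat.
Proof.
move=> dE; have EE : E%:Z = (E %/ `|denq q|)%N%:Z * denq q.
  by rewrite -{1}(divnK dE) PoszM absz_denq.
rewrite -[E%:R]/(E%:Z%:~R) EE /scaled !intrM numqE; ring.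
Qed.

Lemma scaled_le T E q : height T q -> `|scaled E q| <= (2 ^ T * E)%N%:Z.
Proof.
case/andP=> qT _; rewrite /scaled normrM PoszM ler_pM //.
by rewrite ger0_norm // lez_nat leq_div.
Qed.

(* [entry_bits T] bounds the entries of a system of at most T equations of height
   T after multiplication by all denominators of the matrix and right-hand side;
   in [cramer_bits T], [T * T] accounts for the factorial of the Leibniz formula. *)
Definition entry_bits T : nat := T + T * T + T * T * T.
Definition cramer_bits T : nat := T * T + entry_bits T * T + entry_bits T + T.

Lemma fact_le k T : (k <= T)%N -> (k`! <= 2 ^ (T * T))%N.
Proof.
move=> kT; rewrite (@leq_trans (k ^ k)) //; last first.
  rewrite expnM (@leq_trans ((2 ^ T) ^ k)) ?leq_pexp2l ?expn_gt0 //.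
  by case: k kT => // k kT; rewrite leq_exp2r // (leq_trans kT) // ltnW // ltn_expl.
elim: k {kT} => // k IH; rewrite factS expnS leq_mul // (leq_trans IH) //.
by case: k {IH} => // k; rewrite leq_exp2r.
Qed.

Lemma det_bits T k (M : 'M[int]_k) : (k <= T)%N ->
  (forall i j, `|M i j| <= (2 ^ entry_bits T)%N%:Z) ->
  `|\det M| <= (2 ^ (T * T + entry_bits T * T))%N%:Z.
Proof.
move=> kT /absdet_le /le_trans -> //; rewrite lez_nat expnD leq_mul ?fact_le //.
by rewrite -expnM leq_pexp2l // leq_mul.
Qed.

(** Cramer's rule over the integers: clearing all denominators leaves the solution unchanged and
    makes it a quotient of integers bounded through determinants. *)
Lemma height_solution T m k (M : 'M[rat]_(m, k)) (r : 'cV[rat]_m) (z : 'cV[rat]_k) :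
  row_free M -> row_full M -> (k <= T)%N ->
  (forall i j, height T (M i j)) -> (forall i, height T (r i 0)) ->
  M *m z = r -> forall i, height (cramer_bits T) (z i 0).
Proof.
move=> Mfree Mfull; have mk : m = k by rewrite -(eqP Mfree) (eqP Mfull).
subst k => mT MT rT Mz i.
(* The product of all denominators, not their least common multiple: its size is read off from the
   number of factors. *)
pose E := ((\prod_(i < m) \prod_(j < m) `|denq (M i j)|) *
  \prod_(i < m) `|denq (r i 0%R)|)%N.
have prod_le (F : 'I_m -> nat) b : (forall i, (F i <= 2 ^ b)%N) ->
    (\prod_(i < m) F i <= 2 ^ (T * b))%N.
  move=> Fb; rewrite (@leq_trans (\prod_(i < m) 2 ^ b)) //.
    by apply: leq_prod => a _.
  by rewrite prod_nat_const card_ord -expnM leq_pexp2l // mulnC leq_mul2r mT orbT.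
have E_le : (E <= 2 ^ (T * T * T + T * T))%N.
  rewrite -mulnA expnD leq_mul //.
    by apply: (prod_le) => a; apply: prod_le => b; case/andP: (MT a b).
  by apply: prod_le => a; case/andP: (rT a).
have ME a b : (`|denq (M a b)| %| E)%N.
  by rewrite /E (bigD1 a) //= (bigD1 b) //= -!mulnA dvdn_mulr.
have rE a : (`|denq (r a 0%R)| %| E)%N.
  by rewrite /E [X in (_ * X)%N](bigD1 a) //= mulnCA dvdn_mulr.
pose N : 'M[int]_m := map_mx (scaled E) M.
pose v : 'cV[int]_m := map_mx (scaled E) r.
have NE : map_mx intr N = E%:R *: M.
  by apply/matrixP=> a b; rewrite !mxE scaledE.
have vE : map_mx intr v = E%:R *: r.
  by apply/matrixP=> a b; rewrite !mxE (ord1 b) scaledE.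
have scaled_bits q : height T q -> `|scaled E q| <= (2 ^ entry_bits T)%N%:Z.
  move=> /(@scaled_le T E) /le_trans -> //.
  by rewrite lez_nat /entry_bits -addnA expnD leq_mul // [(T * T + _)%N]addnC.
(* Cramer's rule in adjugate form, which follows from adj(N) N = det(N) I. *)
have detE : map_mx intr (\adj N *m v) = (\det N)%:~R *: z.
  rewrite map_mxM map_mx_adj vE -Mz scalemxAl -NE mulmxA mul_adj_mx det_map_mx.
  by rewrite mul_scalar_mx.
have det0 : \det N != 0.
  have : \det (map_mx intr N : 'M[rat]_m) != 0.
    rewrite NE detZ mulf_neq0 //; last first.
      by rewrite -unitfE -[_ \is a _]/(M \in unitmx) -row_free_unit.
    rewrite expf_neq0 // pnatr_eq0 -lt0n /E muln_gt0.
    by rewrite !prodn_gt0 // => a; rewrite ?prodn_gt0 // => *; rewrite absz_gt0 denq_eq0.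
  by rewrite det_map_mx intr_eq0.
have -> : z i 0 = ((\adj N *m v) i 0)%:~R / (\det N)%:~R.
  have := congr1 (fun w : 'cV[rat]_m => w i 0) detE; rewrite !mxE => ->.
  by rewrite mulrC mulKf // intr_eq0.
(* The numerator is a sum of m products of a cofactor and an entry; m <= 2^T accounts for the last
   summand of [cramer_bits]. *)
apply: height_frac => //.
  rewrite -lez_nat abszE mxE (le_trans (ler_norm_sum _ _ _)) //.
  rewrite (@le_trans _ _ (\sum_(j < m) (2 ^ (T * T + entry_bits T * T + entry_bits T))%N%:Z)) //.
    apply: ler_sum => j _; rewrite normrM expnD PoszM ler_pM //; last first.
      by rewrite mxE scaled_bits.
    rewrite mxE /cofactor normrM normrX normrN1 expr1n mul1r det_bits //.
      exact: leq_trans (leq_pred _) mT.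
    by move=> a b; rewrite !mxE scaled_bits.
  rewrite sumr_const card_ord -mulr_natr natz -PoszM lez_nat /cramer_bits [leqRHS]expnD leq_mul //.
  by rewrite (leq_trans mT) // ltnW // ltn_expl.
rewrite -lez_nat abszE (le_trans (det_bits mT _)) //.
  by move=> a b; rewrite mxE scaled_bits.
by rewrite lez_nat leq_pexp2l // /cramer_bits -addnA leq_addr.
Qed.

(** The columns of the inverse solve systems with unit vectors on the right, so the entries of the
    inverse are bounded by [height_solution]; the extra T in the exponent pays for the sum over m <=
    2^T terms. *)
Lemma norm_solution_le T m k (M : 'M[rat]_(m, k)) (z : 'cV[rat]_k) (e : rat) :
  row_free M -> row_full M -> (k <= T)%N -> (forall i j, height T (M i j)) ->
  (forall j, `|(M *m z) j 0| <= e) -> forall i, `|z i 0| <= 2 ^+ (T + cramer_bits T) * e.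
Proof.
move=> Mfree Mfull; have mk : m = k by rewrite -(eqP Mfree) (eqP Mfull).
subst k => mT MT Mz i.
have Mu : M \in unitmx by rewrite -row_free_unit.
have Vb a b : `|invmx M a b| <= 2 ^+ cramer_bits T.
  have -> : invmx M a b = col b (invmx M) a 0 by rewrite mxE.
  apply: height_le; apply: (@height_solution _ _ _ M (col b 1%:M)) => //.
    by move=> c; rewrite !mxE; case: eqP => _; rewrite ?height1 ?height0.
  by rewrite !colE mulmxA mulmxV.
rewrite -[z](mulKmx Mu) mxE (le_trans (ler_norm_sum _ _ _)) //.
rewrite (@le_trans _ _ (\sum_(j < m) 2 ^+ cramer_bits T * e)) //.
  by apply: ler_sum => j _; rewrite normrM ler_pM.
rewrite sumr_const card_ord -[leLHS]mulr_natl exprD -[leRHS]mulrA ler_wpM2r //.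
  by rewrite mulr_ge0 ?exprn_ge0 // (le_trans _ (Mz i)).
by rewrite -natrX ler_nat (leq_trans mT) // ltnW // ltn_expl.
Qed.
(** * Polynomial bounds and running times *)

Definition polyb (f : nat -> nat) : Prop :=
  exists P : {poly nat}, forall s, (f s <= P.[s])%N.

(** Coefficients in [nat] make polynomials monotone, which is what closes [polyb] under
    composition. *)
Lemma horner_nat_mono (P : {poly nat}) s t : (s <= t)%N -> (P.[s] <= P.[t])%N.
Proof.
move=> st; rewrite !horner_coef; apply: leq_sum => i _.
by rewrite leq_mul // !natrXE; case: (nat_of_ord i) => // k; rewrite leq_exp2r.
Qed.

Lemma polyb_horner (P : {poly nat}) : polyb (fun s => P.[s]).
Proof. by exists P. Qed.

Lemma polyb_cst k : polyb (fun=> k).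
Proof. by exists k%:P => s; rewrite hornerC. Qed.

Lemma polyb_id : polyb id.
Proof. by exists 'X => s; rewrite hornerX. Qed.

Lemma polybD f g : polyb f -> polyb g -> polyb (fun s => f s + g s)%N.
Proof. by case=> P fP [Q gQ]; exists (P + Q) => s; rewrite hornerD leq_add. Qed.

Lemma polybM f g : polyb f -> polyb g -> polyb (fun s => f s * g s)%N.
Proof. by case=> P fP [Q gQ]; exists (P * Q) => s; rewrite hornerM leq_mul. Qed.

Lemma polybS f : polyb f -> polyb (fun s => (f s).+1).
Proof.
case=> P fP; exists (P + 1%:P) => s.
by rewrite hornerD hornerC -[leqRHS]/(P.[s] + 1)%N addn1 ltnS.
Qed.

Lemma polyb_comp f g : polyb f -> polyb g -> polyb (fun s => f (g s)).
Proof.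
case=> P fP [Q gQ]; exists (P \Po Q) => s; rewrite horner_comp.
by rewrite (leq_trans (fP _)) // horner_nat_mono.
Qed.

(** * Triples for timed computations *)

(** A Hoare triple with resources: at most c oracle calls, at most b bit operations, and
    postcondition Q. *)
Definition runs T (t : timed T) (c b : nat) (Q : T -> Prop) : Prop :=
  [/\ (calls_of t <= c)%N, (bits_of t <= b)%N & Q (val_of t)].

Lemma runs_weaken T (t : timed T) c b b' (Q Q' : T -> Prop) :
  runs t c b Q -> (b <= b')%N -> (forall x, Q x -> Q' x) -> runs t c b' Q'.
Proof. by case=> tc tb tQ bb QQ; split; rewrite ?(leq_trans tb) //; apply: QQ. Qed.

Lemma runs_ret T (x : T) c (Q : T -> Prop) : Q x -> runs (tret x) c 0 Q.
Proof. by []. Qed.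

Lemma runs_bind T U (a : timed T) (f : T -> timed U) c c' b b' Q Q' :
  runs a c b Q -> (forall x, Q x -> runs (f x) c' b' Q') ->
  runs (tbind a f) (c + c') (b + b') Q'.
Proof.
case=> ac ab aQ /(_ _ aQ) [fc fb fQ]; split => //=; exact: leq_add.
Qed.

(** The form of [runs_bind] for a first part without oracle calls, so that unification meets [c]
    instead of [0 + c]. *)
Lemma runs_bind0 T U (a : timed T) (f : T -> timed U) c b b' Q Q' :
  runs a 0 b Q -> (forall x, Q x -> runs (f x) c b' Q') ->
  runs (tbind a f) c (b + b') Q'.
Proof. exact: runs_bind. Qed.

(** The dimension enters the cost only through its bound T, which keeps all costs functions of a
    single size parameter. *)
Lemma runs_col T n (f : 'I_n -> timed rat) b (Q : 'I_n -> rat -> Prop) :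
  (n <= T)%N -> (forall i, runs (f i) 0 b (Q i)) ->
  runs (tcol f) 0 (T * b) (fun v => forall i, Q i (v i 0)).
Proof.
move=> nT fQ; split=> /=; last by move=> i; rewrite mxE; case: (fQ i).
  by rewrite leqn0 big1 // => i _; apply/eqP; rewrite -leqn0; case: (fQ i).
by rewrite (leq_trans (leq_sum_ord (b := b) _)) ?leq_mul // => i; case: (fQ i).
Qed.

Lemma runs_mat T m n (f : 'I_m -> 'I_n -> timed rat) b (Q : 'I_m -> 'I_n -> rat -> Prop) :
  (m <= T)%N -> (n <= T)%N -> (forall i j, runs (f i j) 0 b (Q i j)) ->
  runs (tmat f) 0 (T * (T * b)) (fun M => forall i j, Q i j (M i j)).
Proof.
move=> mT nT fQ; split=> /=; last by move=> i j; rewrite mxE; case: (fQ i j).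
  by rewrite leqn0 !big1 // => i _; rewrite !big1 // => j _; apply/eqP;
    rewrite -leqn0; case: (fQ i j).
rewrite (leq_trans (leq_sum_ord (b := T * b) _)) ?leq_mul // => i.
by rewrite (leq_trans (leq_sum_ord (b := b) _)) ?leq_mul // => j; case: (fQ i j).
Qed.

Lemma runs_forall T n (f : 'I_n -> timed bool) b (P : 'I_n -> bool) :
  (n <= T)%N -> (forall i, runs (f i) 0 b (fun v => v = P i)) ->
  runs (tforall f) 0 (T * b) (fun v => v = [forall i, P i]).
Proof.
move=> nT fQ; split=> /=; last by apply: eq_forallb => i; case: (fQ i).
  by rewrite leqn0 big1 // => i _; apply/eqP; rewrite -leqn0; case: (fQ i).
by rewrite (leq_trans (leq_sum_ord (b := b) _)) ?leq_mul // => i; case: (fQ i).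
Qed.

(** I is the loop invariant, indexed by the number of entries already processed. *)
Lemma runs_fold T U n (f : U -> 'I_n -> timed U) s0 b (I : nat -> U -> Prop) :
  (n <= T)%N -> I 0%N s0 ->
  (forall (i : 'I_n) s, I i s -> runs (f s i) 0 b (I i.+1)) ->
  runs (tfold f s0) 0 (T * b) (I n).
Proof.
move=> nT I0 fI.
(* Generalized for induction to a run of consecutive indices starting at j, entered with an
   accumulator of cost c. *)
suff fold_runs (s : seq 'I_n) acc j c : map val s = iota j (size s) ->
    runs acc 0 c (I j) ->
    runs (foldl (fun acc i => let! x := acc in f x i) acc s) 0
      (c + size s * b) (I (j + size s)%N).
  have := fold_runs (enum 'I_n) (tret s0) 0%N 0%N.
  rewrite val_enum_ord size_enum_ord => /(_ erefl (runs_ret _ I0)) folded.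
  by apply: runs_weaken folded _ _; rewrite // leq_mul.
elim: s acc j c => [|i s IH] acc j c /=; first by rewrite mul0n !addn0.
case=> <- sE accI; rewrite mulSn addnA -addSnnS; apply: IH => //.
exact: runs_bind0 accI (fI i).
Qed.

(** * Heights of dot products, bounded LPs and basic solutions *)

(** An initial value of height T, then per step a product of height 2T and one bit for the
    subtraction. The factor [T.+1] lets the bound cover a single difference, of height 2T + 1, even
    when T = 0. *)
Definition dot_bits T : nat := T + T.+1 * (2 * T + 1).

Lemma dot_bits_ge T : (T <= dot_bits T)%N.
Proof. exact: leq_addr. Qed.

Lemma cramer_bits_ge T : (T <= cramer_bits T)%N.
Proof. exact: leq_addl. Qed.

Lemma sum_prefixS n (P : pred 'I_n) (F : 'I_n -> rat) (i0 : 'I_n) :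
  \sum_(i | P i && (i < i0.+1)%N) F i =
  \sum_(i | P i && (i < i0)%N) F i + (if P i0 then F i0 else 0).
Proof.
rewrite big_mkcond (bigD1 i0) //= ltnSn andbT addrC; congr (_ + _).
rewrite [RHS]big_mkcond [RHS](bigD1 i0) //= ltnn andbF add0r.
apply: eq_bigr => i ii0; rewrite ltnS leq_eqVlt.
by rewrite -[(_ == _ :> nat)]/(i == i0) (negPf ii0).
Qed.

(** Every partial sum is an operand of the next subtraction, so prefixes have to be bounded and not
    just the final value. P restricts the sum to nonbasic indices where needed. *)
Lemma height_prefix T n (P : pred 'I_n) (s0 : rat) (u v : 'I_n -> rat) j :
  (j <= n)%N -> height T s0 -> (forall i, height T (u i)) -> (forall i, height T (v i)) ->
  height (T + j * (2 * T + 1)) (s0 - \sum_(i | P i && (i < j)%N) u i * v i).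
Proof.
move=> jn s0T uT vT; elim: j jn => [|j IH] jn.
  by rewrite big1 ?subr0 ?addn0 // => i; rewrite ltn0 andbF.
have {}IH := IH (ltnW jn); rewrite (sum_prefixS P _ (Ordinal jn)) /=.
case: ifP => _; last by rewrite addr0; apply: height_mono IH; lia.
rewrite opprD addrA; apply: height_mono (heightB IH (heightM (uT _) (vT _))); lia.
Qed.

Lemma prefix_bits T n j : (j <= n)%N -> (n <= T)%N -> (T + j * (2 * T + 1) <= dot_bits T)%N.
Proof. by rewrite /dot_bits; nia. Qed.

Lemma height_subdot T n (P : pred 'I_n) (s0 : rat) (u v : 'I_n -> rat) :
  (n <= T)%N -> height T s0 -> (forall i, height T (u i)) -> (forall i, height T (v i)) ->
  height (dot_bits T) (s0 - \sum_(i | P i) u i * v i).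
Proof.
move=> nT s0T uT vT; apply: height_mono (prefix_bits (leqnn n) nT) _.
rewrite (eq_bigl (fun i => P i && (i < n)%N)); first exact: height_prefix.
by move=> i; rewrite ltn_ord andbT.
Qed.

Record lp_bounded (T m n : nat) (L : lp m n) : Prop := LpBounded {
  lpb_rows : (m <= T)%N;
  lpb_cols : (n <= T)%N;
  lpb_A : forall i j, height T (lpA L i j);
  lpb_b : forall j, height T (lpb L j 0);
  lpb_l : forall i, height T (lpl L i 0);
  lpb_c : forall i, height T (lpc L i 0) }.

Lemma lp_bounded_mono T T' m n (L : lp m n) : (T <= T')%N ->
  lp_bounded T L -> lp_bounded T' L.
Proof.
move=> TT' [mT nT AT bT lT cT].
by split=> *; rewrite ?(leq_trans _ TT') //; apply: height_mono TT' _.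
Qed.

Definition basis_compatible m n (L : lp m n) (B : {set 'I_n}) (x : 'cV[rat]_n) : Prop :=
  lpA L *m x = lpb L /\ forall i, i \notin B -> x i 0 = lpl L i 0.

Lemma basis_mx_free m n (A : 'M[rat]_(m, n)) B : is_basis A B ->
  row_free (basis_cols A B) /\ row_full (basis_cols A B).
Proof.
case=> Bm; rewrite /row_free /row_full mxrank_tr => /eqP BB.
by rewrite BB eqxx Bm eqxx.
Qed.

Lemma sum_basis m n (A : 'M[rat]_(m, n)) (B : {set 'I_n}) (x : 'cV[rat]_n) j :
  (A *m x) j 0 = (basis_cols A B *m \col_k x (enum_val k) 0) j 0 +
    \sum_(i | i \notin B) A j i * x i 0.
Proof.
rewrite !mxE (bigID (mem B)) /=; congr (_ + _).
by rewrite big_enum_val; apply: eq_bigr => k _; rewrite !mxE.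
Qed.

(** The maximum is specified by its order properties: it bounds everything and lies below every
    strict bound. The abstract g covers absolute values, plain entries and negated entries alike. *)
Lemma runs_max_fold T (C : bit_cost) n (g : 'I_n -> timed rat) (F : 'I_n -> rat)
    (d0 : rat) b H :
  (n <= T)%N -> height H d0 -> (forall i, height H (F i)) ->
  (forall d i, height H d ->
     runs (let! t := g i in tmax C d t) 0 b (fun v => v = Num.max d (F i))) ->
  runs (tfold (fun d i => let! t := g i in tmax C d t) d0) 0 (T * b)
    (fun d => [/\ d0 <= d, forall i, F i <= d,
                  forall e, d0 < e -> (forall i, F i < e) -> d < e & height H d]).
Proof.
move=> nT d0H FH gP.
pose I (j : nat) (d : rat) := [/\ d0 <= d, forall i : 'I_n, (i < j)%N -> F i <= d,
  forall e, d0 < e -> (forall i, F i < e) -> d < e & height H d].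
apply: runs_weaken (runs_fold (I := I) (b := b) nT _ _) _ _ => //.
  move=> i d [d0d Fd de dH]; apply: runs_weaken (gP d i dH) _ _ => // _ ->; split.
  - by rewrite le_max d0d.
  - move=> k; rewrite ltnS leq_eqVlt => /predU1P[/val_inj ->|/Fd Fk].
      by rewrite le_max lexx orbT.
    by rewrite le_max Fk.
  - by move=> e d0e Fe; rewrite gt_max de //= Fe.
  - by apply: height_max.
by move=> d [? Fd ? ?]; split=> // i; apply: Fd.
Qed.

(** The right-hand side of the primal basis system is itself a dot product, of height [dot_bits T],
    to which Cramer's rule is applied. *)
Definition basic_bits T : nat := cramer_bits (dot_bits T).

Lemma basic_bits_ge T : (dot_bits T <= basic_bits T)%N /\ (T <= basic_bits T)%N.
Proof.
by split; rewrite ?cramer_bits_ge // (leq_trans (dot_bits_ge T)) // cramer_bits_ge.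
Qed.

(** [vs_lt] is the leastness of the maximum in strict form, matching the strict accuracy of the
    iterates. *)
Record violation_spec m n (bh : 'cV[rat]_m) (lh ch : 'cV[rat]_n) (d : rat) : Prop :=
  ViolationSpec {
    vs_eq : forall j, `|bh j 0| <= d;
    vs_lb : forall i, lh i 0 <= d;
    vs_dual : forall i, - ch i 0 <= d;
    vs_slack : `|\sum_i lh i 0 * ch i 0| <= d;
    vs_lt : forall e, (forall j, `|bh j 0| < e) -> (forall i, lh i 0 < e) ->
      (forall i, - ch i 0 < e) -> `|\sum_i lh i 0 * ch i 0| < e -> d < e }.

Definition refined_lp m n (L : lp m n) (D : rat) (bh : 'cV[rat]_m) (lh ch : 'cV[rat]_n) : lp m n :=
  LP (lpA L) (D *: bh) (D *: lh) (D *: ch).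

(** Both 1/d and alpha 2^e exceed 2^e, the first because the bound on d is strict and the second
    because alpha >= 2; so the exponent rises by at least one. The rise is at most alpha because
    alpha <= 2^alpha. *)
Lemma pow2_ceil_refine alpha e (d : rat) : (2 <= alpha)%N -> 0 < d < 2 ^- e ->
  exists e', [/\ pow2_ceil (1 / Num.max d (1 / (alpha%:R * 2 ^+ e))) = 2 ^+ e',
    (e < e')%N & (e' <= e + alpha)%N].
Proof.
move=> a2 /andP[d0 de]; have a0 : (0 : rat) < alpha%:R by rewrite ltr0n ltnW.
have e0 : (0 : rat) < 2 ^+ e by rewrite exprn_gt0.
set d' := Num.max _ _; set r := 1 / d'.
have ae0 : 0 < alpha%:R * 2 ^+ e :> rat by rewrite mulr_gt0.
have d'0 : 0 < d' by rewrite lt_max d0.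
have rlo : 2 ^+ e < r.
  rewrite /r div1r -[ltLHS]invrK ltf_pV2 ?posrE ?invr_gt0 // gt_max de /=.
  rewrite div1r ltf_pV2 ?posrE //.
  by rewrite -[ltLHS]mul1r ltr_pM2r // ltr1n.
have rhi : r <= 2 ^+ (e + alpha).
  rewrite /r div1r -[leRHS]invrK lef_pV2 ?posrE ?invr_gt0 ?exprn_gt0 //.
  rewrite le_max; apply/orP; right; rewrite div1r lef_pV2 ?posrE ?exprn_gt0 //.
  by rewrite exprD mulrC ler_wpM2l ?(ltW e0) // -natrX ler_nat ltnW // ltn_expl.
have [clo chi] := andP (ceil_log2P (lt_trans e0 rlo)).
rewrite /pow2_ceil; move: clo chi; set c := ceil_log2 r => clo chi.
have ec : e%:Z < c.
  by rewrite -(@ltr_eXz2l rat 2) // -exprnP (lt_le_trans rlo).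
have ce : c - 1 < (e + alpha)%N%:Z.
  by rewrite -(@ltr_eXz2l rat 2) // -exprnP (lt_le_trans clo).
case: c ec ce {clo chi} => [e'|//] ee' e'e; exists e'; split=> //; lia.
Qed.

Lemma in_fixed_height p q : in_fixed p q -> height (2 * p) q.
Proof.
case=> z zp ->; rewrite -natrX -[_%:R]/((2 ^ p)%N%:Z%:~R); apply: height_frac.
- by rewrite -lt0n expn_gt0.
- by rewrite -lez_nat abszE.
- by rewrite leq_pexp2l // leq_pmull.
Qed.

(** * Accuracy of the iterates and verification of the basis *)

(** The oracle guarantee carried back from the scaled problem to L, with eta and sigma relaxed to a
    strict 1; no real number is left. *)
Record close_pair m n (L : lp m n) (e : nat) (x : 'cV[rat]_n) (y : 'cV[rat]_m)
    (B : {set 'I_n}) : Prop := ClosePair {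
  cp_basis : is_basis (lpA L) B;
  cp_eq : forall j, `|(lpb L - lpA L *m x) j 0| < 2 ^- e;
  cp_lb : forall i, lpl L i 0 - x i 0 < 2 ^- e;
  cp_dual : forall i, - reduced_cost L y i 0 < 2 ^- e;
  cp_slack : `|\sum_i (lpl L i 0 - x i 0) * reduced_cost L y i 0| < 2 ^- e;
  cp_nonbasic : forall i, i \notin B -> `|lpl L i 0 - x i 0| < 2 ^- e;
  cp_basic : forall i, i \in B -> `|reduced_cost L y i 0| < 2 ^- e }.

(** Residuals, slacks and reduced costs of the corrected pair are 2^-e times those of the answer in
    the refined problem. *)
Lemma good_answer_close (R : realType) p (eta sigma : R) m n (L : lp m n) e
    (x : 'cV[rat]_n) (y : 'cV[rat]_m) (a : answer m n) :
  eta < 1 -> sigma < 1 ->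
  good_answer p eta sigma
    (refined_lp L (2 ^+ e) (lpb L - lpA L *m x) (lpl L - x) (reduced_cost L y)) a ->
  close_pair L e (x + 2 ^- e *: ansx a) (y + 2 ^- e *: ansy a) (ansB a).
Proof.
move=> eta1 sigma1; set D : rat := 2 ^+ e; set L' := refined_lp _ _ _ _ _ => -[_ _ aB].
have D0 : 0 < D by rewrite exprn_gt0.
have Dn0 : D != 0 by rewrite gt_eqF.
have Di0 : 0 < D^-1 by rewrite invr_gt0.
have ratr_lt1 (q : rat) (t : R) : t < 1 -> ratr q <= t -> q < 1.
  by move=> t1 qt; rewrite -(ltr_rat R) rmorph1 (le_lt_trans qt).
have eqE : lpb L - lpA L *m (x + D^-1 *: ansx a) = - (D^-1 *: (lpA L' *m ansx a - lpb L')).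
  rewrite mulmxDr -scalemxAr scalerBr scalerA mulVf // scale1r.
  by rewrite [RHS]opprB opprD addrA.
have lbE i : lpl L i 0 - (x + D^-1 *: ansx a) i 0 = D^-1 * (lpl L' i 0 - ansx a i 0).
  by rewrite !mxE; field.
have rcE : reduced_cost L (y + D^-1 *: ansy a) = D^-1 *: reduced_cost L' (ansy a).
  rewrite /reduced_cost /= mulmxDr -scalemxAr scalerBr scalerA mulVf // scale1r opprD.
  by rewrite addrA.
have rciE i : reduced_cost L (y + D^-1 *: ansy a) i 0 = D^-1 * reduced_cost L' (ansy a) i 0.
  by rewrite rcE mxE.
have small (q : rat) : `|q| < 1 -> `|D^-1 * q| < D^-1.
  by move=> q1; rewrite normrM gtr0_norm // -[ltRHS]mulr1 ltr_pM2l.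
move=> aeq alb adual aslack anon abas; split=> //.
- move=> j; rewrite eqE mxE normrN mxE small //.
  exact: ratr_lt1 eta1 (aeq j).
- move=> i; rewrite lbE -[ltRHS]mulr1 ltr_pM2l //; apply: ratr_lt1 eta1 _.
  by rewrite rmorphB /= lerBlDr -lerBlDl.
- move=> i; rewrite rciE -mulrN -[ltRHS]mulr1 ltr_pM2l //; apply: ratr_lt1 eta1 _.
  by rewrite rmorphN /= lerNl; apply: adual.
(* Slackness is bilinear and scales by the square of [D^-1]; one factor gives the bound, the other
   is at most 1. *)
- have -> : \sum_i (lpl L i 0 - (x + D^-1 *: ansx a) i 0) *
      reduced_cost L (y + D^-1 *: ansy a) i 0 =
    D^-1 * (D^-1 * - ((ansx a - lpl L')^T *m reduced_cost L' (ansy a)) 0 0).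
    rewrite [in RHS]mxE -sumrN !mulr_sumr; apply: eq_bigr => i _.
    have -> : (ansx a - lpl L')^T 0 i = ansx a i 0 - lpl L' i 0 by rewrite !mxE.
    by rewrite lbE rciE; ring.
  apply: small; rewrite normrM normrN (ger0_norm (ltW Di0)).
  apply: le_lt_trans (_ : 1 * `|((ansx a - lpl L')^T *m reduced_cost L' (ansy a)) 0 0| < 1).
    by rewrite ler_wpM2r // invf_le1 // /D -natrX ler1n expn_gt0.
  by rewrite mul1r; apply: ratr_lt1 sigma1 aslack.
- by move=> i iB; rewrite lbE small // distrC; apply: ratr_lt1 eta1 (anon i iB).
- by move=> i iB; rewrite rciE small //; apply: ratr_lt1 eta1 (abas i iB).
Qed.

(** * Duality, and signs decided by heights *)

Lemma duality_gap m n (L : lp m n) (x : 'cV[rat]_n) (y : 'cV[rat]_m) :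
  lpA L *m x = lpb L ->
  primal_value L x - dual_value L y =
    \sum_i (x i 0 - lpl L i 0) * reduced_cost L y i 0.
Proof.
move=> Ax; have -> : \sum_i (x i 0 - lpl L i 0) * reduced_cost L y i 0 =
    ((x - lpl L)^T *m reduced_cost L y) 0 0.
  by rewrite mxE; apply: eq_bigr => i _; rewrite !mxE.
have -> : primal_value L x = (x^T *m lpc L) 0 0.
  by rewrite /primal_value !mxE; apply: eq_bigr => i _; rewrite !mxE mulrC.
have bE : (lpb L)^T *m y = x^T *m ((lpA L)^T *m y) by rewrite -Ax trmx_mul mulmxA.
have -> : (x - lpl L)^T = x^T - (lpl L)^T by rewrite linearB.
rewrite /dual_value bE /reduced_cost mulmxBl [x^T *m (_ - _)]mulmxBr.
by rewrite !mxE; ring.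
Qed.

(** The gap is a sum of nonnegative products on feasible pairs, which is weak duality; a pair with
    zero gap attains the bound on both sides. *)
Lemma optimal_pairP m n (L : lp m n) (x : 'cV[rat]_n) (y : 'cV[rat]_m) :
  primal_feasible L x -> dual_feasible L y ->
  \sum_i (x i 0 - lpl L i 0) * reduced_cost L y i 0 = 0 -> optimal_pair L x y.
Proof.
move=> xF yF gap0.
have weak x' y' : primal_feasible L x' -> dual_feasible L y' ->
    dual_value L y' <= primal_value L x'.
  case=> Ax' x'l y'F; rewrite -subr_ge0 duality_gap // sumr_ge0 // => i _.
  by rewrite mulr_ge0 // subr_ge0.
have strong : primal_value L x = dual_value L y.
  by apply/eqP; rewrite -subr_eq0 duality_gap ?gap0 //; case: xF.
by split=> // [x' x'F|y' y'F]; [rewrite strong|rewrite -strong]; apply: weak.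
Qed.

(* First bracket: distance of the basic solution from an iterate, in units of
   2^-e.  Second bracket: height of the slacks and reduced costs of the basic
   solution. *)
Definition verify_bits T : nat :=
  (3 * T + 2 + cramer_bits T) + (T + basic_bits T + dot_bits (cramer_bits T) + 1).

Lemma ler_exp2 (k l : nat) : (k <= l)%N -> 2 ^+ k <= 2 ^+ l :> rat.
Proof. by move=> kl; rewrite ler_weXn2l. Qed.

Lemma add_exp2_le k (t : rat) : 0 <= t -> t + 2 ^+ k * t <= 2 ^+ k.+1 * t.
Proof.
move=> t0; rewrite exprS -mulrA mulr_natl mulr2n lerD2r -[leLHS]mul1r ler_wpM2r //.
exact: ler_exp2 (leq0n k).
Qed.

Lemma nat_le_exp2 n T : (n <= T)%N -> n%:R <= 2 ^+ T :> rat.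
Proof. by move=> nT; rewrite -natrX ler_nat (leq_trans nT) // ltnW // ltn_expl. Qed.

(** A positive q would be at least 2^-H, too large for an upper bound below 2^(k - e). *)
Lemma height_le0 H k e (q : rat) :
  height H q -> q < 2 ^+ k * 2 ^- e -> (H + k <= e)%N -> q <= 0.
Proof.
move=> qH qlt Hke; rewrite leNgt; apply/negP => /(height_gap qH) /le_lt_trans /(_ qlt).
rewrite ltr_pdivlMr ?exprn_gt0 // mulrC ltr_pdivrMr ?exprn_gt0 // ltNge -exprD.
by rewrite ler_exp2 // addnC.
Qed.

(** The difference w of iterate and basic solution is small off the basis by closeness, and on the
    basis because it solves a system in A_{.B} with small right-hand side. The bound violations of
    the basic solution are then too small to be positive. *)
Lemma basis_primal_verified T m n (L : lp m n) e x y B (x' : 'cV[rat]_n) :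
  lp_bounded T L -> close_pair L e x y B -> basis_compatible L B x' ->
  (forall i, height (basic_bits T) (x' i 0)) -> (verify_bits T <= e)%N ->
  primal_feasible L x'.
Proof.
case=> mT nT AT bT lT cT [Bb xeq xlb _ _ xN _] [Ax' x'N] x'T Te; split=> // i.
have BT : (#|B| <= T)%N by apply: leq_trans nT; rewrite -[n in leqRHS]card_ord max_card.
have [Mfree Mfull] := basis_mx_free Bb; set eps : rat := 2 ^- e in xeq xlb xN.
have eps0 : 0 <= eps by rewrite invr_ge0 exprn_ge0.
pose w := x - x'.
have wN k : k \notin B -> `|w k 0| <= eps.
  by move=> kB; rewrite /w mxE [(- x') k 0]mxE (x'N k kB) distrC ltW // xN.
pose z : 'cV[rat]_#|B| := \col_k w (enum_val k) 0.
(* A w is minus the residual of x. Moving the at most 2^T nonbasic terms, each at most 2^T eps, to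
   the right leaves the basic part. *)
have Mz j : `|(basis_cols (lpA L) B *m z) j 0| <= 2 ^+ (2 * T + 1) * eps.
  have -> : (basis_cols (lpA L) B *m z) j 0 =
      - (lpb L - lpA L *m x) j 0 - \sum_(k | k \notin B) lpA L j k * w k 0.
    have <- : (lpA L *m w) j 0 = - (lpb L - lpA L *m x) j 0.
      by rewrite mulmxBr Ax' -opprB mxE.
    by rewrite (sum_basis _ B) addrK.
  rewrite (le_trans (ler_normB _ _)) // normrN.
  have sumN : `|\sum_(k | k \notin B) lpA L j k * w k 0| <= 2 ^+ T * (2 ^+ T * eps).
    rewrite (le_trans (ler_norm_sum _ _ _)) //.
    apply: (@le_trans _ _ (\sum_(k < n) 2 ^+ T * eps)).
      rewrite big_mkcond ler_sum // => k _; case: ifPn => kB; last by rewrite mulr_ge0 ?exprn_ge0.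
      by rewrite normrM ler_pM // ?wN // height_le.
    by rewrite sumr_const card_ord -[leLHS]mulr_natl ler_wpM2r ?mulr_ge0 ?exprn_ge0 // nat_le_exp2.
  apply: le_trans (lerD (ltW (xeq j)) sumN) _.
  by rewrite mulrA -exprD addnn -mul2n addn1 add_exp2_le.
have wb k : `|w k 0| <= 2 ^+ (3 * T + 1 + cramer_bits T) * eps.
  case: (boolP (k \in B)) => kB; last first.
    apply: le_trans (wN k kB) _; rewrite -[leLHS]mul1r ler_wpM2r // -(expr0 2).
    exact: ler_exp2.
  have := norm_solution_le Mfree Mfull BT (T := T) _ Mz (enum_rank_in kB k).
  rewrite [z _ _]mxE enum_rankK_in // => zk; apply: le_trans (zk _) _.
    by move=> j l; rewrite mxE.
  by rewrite mulrA -exprD ler_wpM2r // ler_exp2 //; clear; lia.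
(* The violation of the bound by x itself adds the last factor 2 to the bound on w. *)
rewrite -subr_le0; apply: (@height_le0 (T + basic_bits T).+1 (3 * T + 2 + cramer_bits T) e).
- exact: heightB.
- have -> : lpl L i 0 - x' i 0 = (lpl L i 0 - x i 0) + w i 0 by rewrite !mxE; ring.
  apply: lt_le_trans (ltr_leD (xlb i) (le_trans (ler_norm _) (wb i))) _.
  by rewrite addn2 addSn addn1 add_exp2_le.
- by apply: leq_trans Te; rewrite /verify_bits; clear; lia.
Qed.

(** For v = y - y', the entries of A^T v on B are minus the reduced costs of y, hence small;
    inverting the transposed basis matrix makes v small, and multiplying by A^T carries this to the
    reduced costs off B. *)
Lemma basis_dual_verified T m n (L : lp m n) e x y B (y' : 'cV[rat]_m) :
  lp_bounded T L -> close_pair L e x y B ->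
  (forall i, i \in B -> reduced_cost L y' i 0 = 0) ->
  (forall j, height (cramer_bits T) (y' j 0)) -> (verify_bits T <= e)%N ->
  dual_feasible L y'.
Proof.
case=> mT nT AT bT lT cT [Bb _ _ ydual _ _ yB] y'B y'T Te i.
have [Mfree Mfull] := basis_mx_free Bb; set eps : rat := 2 ^- e in ydual yB.
have eps0 : 0 <= eps by rewrite invr_ge0 exprn_ge0.
pose v := y - y'.
have vE k : ((lpA L)^T *m v) k 0 = reduced_cost L y' k 0 - reduced_cost L y k 0.
  have -> : (lpA L)^T *m v = reduced_cost L y' - reduced_cost L y.
    by rewrite /reduced_cost mulmxBr opprB [RHS]addrC addrA subrK.
  by rewrite mxE [X in _ + X]mxE.
have vb j : `|v j 0| <= 2 ^+ (T + cramer_bits T) * eps.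
  apply: (norm_solution_le (M := (basis_cols (lpA L) B)^T)) => //.
  - by rewrite /row_free mxrank_tr.
  - by rewrite /row_full mxrank_tr.
  - by move=> k l; rewrite !mxE.
  move=> k; have -> : ((basis_cols (lpA L) B)^T *m v) k 0 = ((lpA L)^T *m v) (enum_val k) 0.
    by rewrite !mxE; apply: eq_bigr => l _; rewrite !mxE.
  by rewrite vE y'B ?enum_valP // sub0r normrN ltW // yB // enum_valP.
have Avb : `|((lpA L)^T *m v) i 0| <= 2 ^+ (3 * T + cramer_bits T) * eps.
  rewrite mxE (le_trans (ler_norm_sum _ _ _)) //.
  apply: (@le_trans _ _ (\sum_(k < m) 2 ^+ T * (2 ^+ (T + cramer_bits T) * eps))).
    by apply: ler_sum => k _; rewrite normrM ler_pM // mxE height_le.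
  rewrite sumr_const card_ord -[leLHS]mulr_natl.
  apply: (@le_trans _ _ (2 ^+ T * (2 ^+ T * (2 ^+ (T + cramer_bits T) * eps)))).
    by rewrite ler_wpM2r ?nat_le_exp2 // !mulr_ge0 ?exprn_ge0.
  by rewrite !mulrA -!exprD ler_wpM2r // ler_exp2 //; clear; lia.
rewrite -oppr_le0.
apply: (@height_le0 (dot_bits (cramer_bits T)) (3 * T + 1 + cramer_bits T) e).
- rewrite heightN; have TC := cramer_bits_ge T.
  have -> : reduced_cost L y' i 0 = lpc L i 0 - \sum_j lpA L j i * y' j 0.
    by rewrite !mxE; congr (_ - _); apply: eq_bigr => j _; rewrite mxE.
  apply: height_subdot => // [|| j]; first exact: leq_trans mT TC.
    exact: height_mono TC (cT i).
  exact: height_mono TC (AT j i).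
- have -> : - reduced_cost L y' i 0 = - reduced_cost L y i 0 - ((lpA L)^T *m v) i 0.
    by rewrite vE; ring.
  apply: lt_le_trans (ltr_leD (ydual i) (le_trans (ler_norm _) _)) _.
    rewrite normrN; exact: Avb.
  by rewrite addn1 addSn add_exp2_le.
- by apply: leq_trans Te; rewrite /verify_bits; clear; lia.
Qed.

(** * Grid of the iterates and invariant of the refinement *)

(** M counts the oracle answers summed up so far, each of absolute value at most 2^p. *)
Definition on_grid p e M (q : rat) : Prop :=
  (exists z : int, q = z%:~R / 2 ^+ (p + e)) /\ `|q| <= 2 ^+ p * M%:R.

Lemma on_grid0 p e : on_grid p e 0 0.
Proof. by split; [exists 0; rewrite mul0r|rewrite normr0 mulr0]. Qed.

Lemma on_grid_step p e e' M (q t : rat) : (e <= e')%N ->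
  on_grid p e M q -> in_fixed p t -> on_grid p e' M.+1 (q + 2 ^- e' * t).
Proof.
move=> ee' [[z ->] qM] [w wp ->]; split.
  (* As e <= e', the old denominator divides the new one, and the old numerator is merely
     rescaled. *)
  exists (z * (2 ^ (e' - e))%N%:Z + w).
  have -> : (p + e' = (p + e) + (e' - e))%N by lia.
  have -> : (2 : rat) ^+ e' = 2 ^+ e * 2 ^+ (e' - e) by rewrite -exprD subnKC.
  rewrite intrD intrM -[(2 ^ _)%N%:Z%:~R]/((2 ^ (e' - e))%N%:R) natrX !exprD.
  by field; rewrite !expf_neq0.
have p0 : (0 : rat) < 2 ^+ p by rewrite exprn_gt0.
rewrite (le_trans (ler_normD _ _)) // -[M.+1%:R]natr1 mulrDr mulr1 lerD // normrM.
rewrite -[leRHS]mul1r ler_pM //.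
  by rewrite ger0_norm ?invr_ge0 ?exprn_ge0 // invf_le1 ?exprn_gt0 // -natrX ler1n expn_gt0.
rewrite normrM normfV (gtr0_norm p0) ler_pdivrMr // -exprD addnn -mul2n -intr_norm.
by rewrite -natrX -[_%:R]/((2 ^ (2 * p))%N%:Z%:~R) ler_int.
Qed.

Lemma on_grid_height p e M q : on_grid p e M q -> height (2 * p + e + M) q.
Proof.
case=> -[z qE] qM; rewrite qE -natrX -[_%:R]/((2 ^ (p + e))%N%:Z%:~R).
apply: height_frac; first by rewrite -lt0n expn_gt0.
  rewrite -(ler_nat rat) natrX -[`|z|%:R]/((`|z|%N)%:Z%:~R) abszE intr_norm.
  have pe0 : (0 : rat) < 2 ^+ (p + e) by rewrite exprn_gt0.
  have -> : `|z%:~R| = `|q| * 2 ^+ (p + e).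
    by rewrite qE normrM normfV (gtr0_norm pe0) divfK // gt_eqF.
  have -> : (2 * p + e + M = p + M + (p + e))%N by lia.
  rewrite [in leRHS]exprD ler_wpM2r ?(ltW pe0) // (le_trans qM) // exprD ler_wpM2l ?exprn_ge0 //.
  exact: nat_le_exp2.
by rewrite leq_pexp2l //; lia.
Qed.

(** The lower bound on e converts a bound on e into one on the number of iterations; the upper bound
    keeps the iterates small. [N.+1] includes the answer to the initial call. *)
Record state_inv p alpha m n (L : lp m n) (N e : nat) (s : state m n) : Prop := StateInv {
  si_D : st_D s = 2 ^+ e;
  si_ge : (N <= e)%N;
  si_le : (e <= N * alpha)%N;
  si_close : close_pair L e (st_x s) (st_y s) (st_B s);
  si_x : forall i, on_grid p e N.+1 (st_x s i 0);
  si_y : forall j, on_grid p e N.+1 (st_y s j 0) }.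

Lemma violation_optimal m n (L : lp m n) (x : 'cV[rat]_n) (y : 'cV[rat]_m) d :
  violation_spec (lpb L - lpA L *m x) (lpl L - x) (reduced_cost L y) d -> d <= 0 ->
  optimal_pair L x y.
Proof.
case=> veq vlb vdual vslack _ d0; apply: optimal_pairP.
- split=> [|i]; last first.
    by rewrite -subr_le0; have := le_trans (vlb i) d0; rewrite !mxE.
  apply/esym/eqP; rewrite -subr_eq0; apply/eqP/colP=> j.
  by rewrite [RHS]mxE; apply/eqP; rewrite -normr_le0 (le_trans (veq j)).
- by move=> i; rewrite -oppr_le0 (le_trans (vdual i)).
- apply/eqP; rewrite -normr_le0 (le_trans _ d0) // (le_trans _ vslack) // -normrN -sumrN.
  rewrite le_eqVlt; apply/orP; left; apply/eqP; congr `|_|.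
  by apply: eq_bigr => i _; rewrite -mulNr opprB [in RHS]mxE [in RHS]mxE.
Qed.

Lemma violation_lt m n (L : lp m n) e (x : 'cV[rat]_n) (y : 'cV[rat]_m) B d :
  close_pair L e x y B ->
  violation_spec (lpb L - lpA L *m x) (lpl L - x) (reduced_cost L y) d -> d < 2 ^- e.
Proof.
move=> xyB dP; have lE i : (lpl L - x) i 0 = lpl L i 0 - x i 0 by rewrite !mxE.
apply: (vs_lt dP) => [||| ]; first exact: cp_eq xyB.
- by move=> i; rewrite lE; apply: cp_lb xyB i.
- exact: cp_dual xyB.
- by under eq_bigr do rewrite lE; apply: cp_slack xyB.
Qed.
(** * Running time of the algorithm *)

Section Costs.

Variables (C : bit_cost) (S : lin_solver) (p alpha : nat).
(** Bounds uniform over all operations, as functions of the height of the operands or of the size of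
    a system. The unary operations are listed because [Round] is an infinite family, of which only
    [Round p] occurs. *)
Variables W V : nat -> nat.
Hypothesis W1 : forall o N x, List.In o [:: Move; Neg; Abs; Round p; Pow2Ceil] ->
  height N x -> (cost1 C o x <= W N)%N.
Hypothesis W2 : forall o N x y, height N x -> height N y -> (cost2 C o x y <= W N)%N.
Hypothesis SP : forall m k (M : 'M[rat]_(m, k)) (r : 'cV[rat]_m),
  row_free M -> row_full M -> M *m (S M r).1 = r.
Hypothesis SV : forall m k (M : 'M[rat]_(m, k)) (r : 'cV[rat]_m) N,
  row_free M -> row_full M -> (mx_size M + mx_size r <= N)%N -> ((S M r).2 <= V N)%N.

Lemma runs_move N x : height N x -> runs (tmove C x) 0 (W N) (fun v => v = x).
Proof. by move=> xN; split=> //=; apply: W1 => //=; tauto. Qed.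

Lemma runs_neg N x : height N x -> runs (tneg C x) 0 (W N) (fun v => v = - x).
Proof. by move=> xN; split=> //=; apply: W1 => //=; tauto. Qed.

Lemma runs_abs N x : height N x -> runs (tabs C x) 0 (W N) (fun v => v = `|x|).
Proof. by move=> xN; split=> //=; apply: W1 => //=; tauto. Qed.

Lemma runs_round N x : height N x -> runs (tround C p x) 0 (W N) (fun v => v = round_fixed p x).
Proof. by move=> xN; split=> //=; apply: W1 => //=; tauto. Qed.

Lemma runs_pow2 N x : height N x -> runs (tpow2 C x) 0 (W N) (fun v => v = pow2_ceil x).
Proof. by move=> xN; split=> //=; apply: W1 => //=; tauto. Qed.

Section Binary.
Variables (N : nat) (x y : rat).
Hypotheses (xN : height N x) (yN : height N y).

Lemma runs_add : runs (tadd C x y) 0 (W N) (fun v => v = x + y).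
Proof. by split=> //=; apply: W2. Qed.
Lemma runs_sub : runs (tsub C x y) 0 (W N) (fun v => v = x - y).
Proof. by split=> //=; apply: W2. Qed.
Lemma runs_mul : runs (tmul C x y) 0 (W N) (fun v => v = x * y).
Proof. by split=> //=; apply: W2. Qed.
Lemma runs_div : runs (tdiv C x y) 0 (W N) (fun v => v = x / y).
Proof. by split=> //=; apply: W2. Qed.
Lemma runs_le : runs (tle C x y) 0 (W N) (fun v => v = (x <= y)).
Proof. by split=> //=; apply: W2. Qed.
Lemma runs_eq : runs (teq C x y) 0 (W N) (fun v => v = (x == y)).
Proof. by split=> //=; apply: W2. Qed.
Lemma runs_max : runs (tmax C x y) 0 (W N) (fun v => v = Num.max x y).
Proof. by split=> //=; apply: W2. Qed.
End Binary.

Definition dot_cost T : nat := T * (W T + W (dot_bits T)).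

Lemma dot_double_bits T : (T + T <= dot_bits T)%N.
Proof. by rewrite /dot_bits; nia. Qed.

(** One loop serves both the residuals, with nothing skipped, and the right-hand side of the primal
    basis system, with basic indices skipped. *)
Lemma runs_subdot_skip T n (skip : pred 'I_n) s0 (u v : 'I_n -> rat) :
  (n <= T)%N -> height T s0 -> (forall i, height T (u i)) -> (forall i, height T (v i)) ->
  runs (tfold (fun s i => if skip i then tret s
                          else let! t := tmul C (u i) (v i) in tsub C s t) s0) 0 (dot_cost T)
    (fun s => s = s0 - \sum_(i | ~~ skip i) u i * v i /\ height (dot_bits T) s).
Proof.
move=> nT s0T uT vT.
pose I (j : nat) (s : rat) := s = s0 - \sum_(i : 'I_n | ~~ skip i && (i < j)%N) u i * v i.
apply: runs_weaken (runs_fold (I := I) (b := W T + W (dot_bits T)) nT _ _) _ _ => //.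
- by rewrite /I big1 ?subr0 // => i; rewrite ltn0 andbF.
- move=> i s sE; rewrite /I sum_prefixS; case: ifP => Pi; first by split; rewrite //= addr0.
  apply: runs_bind0 (runs_mul (uT i) (vT i)) _ => _ ->.
  apply: runs_weaken (runs_sub (N := dot_bits T) _ _) _ _ => // [||_ ->].
  + rewrite sE; apply: height_mono (height_prefix _ (ltnW (ltn_ord i)) s0T uT vT).
    exact: prefix_bits (ltnW (ltn_ord i)) nT.
  + exact: height_mono (dot_double_bits T) (heightM (uT i) (vT i)).
  + by rewrite sE opprD addrA.
- move=> _ ->.
  have -> : \sum_(i | ~~ skip i && (i < n)%N) u i * v i = \sum_(i | ~~ skip i) u i * v i.
    by apply: eq_bigl => i; rewrite ltn_ord andbT.
  by split; last exact: height_subdot.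
Qed.

Lemma runs_subdot T n s0 (u v : 'I_n -> rat) :
  (n <= T)%N -> height T s0 -> (forall i, height T (u i)) -> (forall i, height T (v i)) ->
  runs (tsubdot C s0 u v) 0 (dot_cost T)
    (fun s => s = s0 - \sum_i u i * v i /\ height (dot_bits T) s).
Proof. exact: (@runs_subdot_skip T n (fun=> false)). Qed.

Definition residual_cost T : nat := T * dot_cost T.

Lemma runs_primal_residual T m n (L : lp m n) (x : 'cV[rat]_n) :
  lp_bounded T L -> (forall i, height T (x i 0)) ->
  runs (tprimal_residual C L x) 0 (residual_cost T)
    (fun r => r = lpb L - lpA L *m x /\ forall j, height (dot_bits T) (r j 0)).
Proof.
case=> mT nT AT bT lT cT xT.
apply: runs_weaken (runs_col mT (fun j => runs_subdot nT (bT j) (AT j) xT)) _ _ => // r rP.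
split=> [|j]; last by case: (rP j).
by apply/colP=> j; case: (rP j) => -> _; rewrite !mxE.
Qed.

Lemma runs_dual_residual T m n (L : lp m n) (y : 'cV[rat]_m) :
  lp_bounded T L -> (forall j, height T (y j 0)) ->
  runs (tdual_residual C L y) 0 (residual_cost T)
    (fun r => r = reduced_cost L y /\ forall i, height (dot_bits T) (r i 0)).
Proof.
case=> mT nT AT bT lT cT yT.
apply: runs_weaken (runs_col nT (fun i =>
  runs_subdot mT (cT i) (fun j => AT j i) yT)) _ _ => // r rP.
split=> [|i]; last by case: (rP i).
apply/colP=> i; case: (rP i) => -> _; rewrite !mxE; congr (_ - _).
by apply: eq_bigr => j _; rewrite !mxE.
Qed.

Definition violation_cost T : nat :=
  dot_cost T + (W (dot_bits T) + (T * (W (dot_bits T) + W (dot_bits T)) +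
    (T * W (dot_bits T) + T * (W (dot_bits T) + W (dot_bits T))))).

Lemma runs_violation T m n (bh : 'cV[rat]_m) (lh ch : 'cV[rat]_n) :
  (m <= T)%N -> (n <= T)%N -> (forall j, height T (bh j 0)) ->
  (forall i, height T (lh i 0)) -> (forall i, height T (ch i 0)) ->
  runs (tviolation C bh lh ch) 0 (violation_cost T)
    (fun d => violation_spec bh lh ch d /\ height (dot_bits T) d).
Proof.
move=> mT nT bT lT cT; have up q : height T q -> height (dot_bits T) q.
  exact/height_mono/dot_bits_ge.
apply: runs_bind0 (runs_subdot nT (height0 _) lT cT) _ => s [sE sT].
apply: runs_bind0 (runs_abs sT) _ => d0 d0E.
have d0T : height (dot_bits T) d0 by rewrite d0E height_norm.
apply: runs_bind0.
  apply: (runs_max_fold mT d0T (F := fun j => `|bh j 0|)).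
    by move=> j; apply/height_norm/up.
  move=> d j dT; apply: runs_bind0 (runs_abs (up _ (bT j))) _ => _ ->.
  by apply: runs_max => //; apply/height_norm/up.
move=> d1 [d01 bd1 d1lt d1T].
have lh_max : runs (tfold (fun d i => tmax C d (lh i 0)) d1) 0 (T * W (dot_bits T))
    (fun d => [/\ d1 <= d, forall i, lh i 0 <= d,
       forall e, d1 < e -> (forall i, lh i 0 < e) -> d < e & height (dot_bits T) d]).
  apply: (runs_max_fold nT d1T (g := fun i => tret (lh i 0))) => [i|d i dT].
    exact: up.
  apply: (runs_bind0 (@runs_ret _ _ _ (fun v => v = lh i 0) erefl)) => _ ->.
  by apply/runs_max/up.
apply: runs_bind0 lh_max _ => d2 [d12 ld2 d2lt d2T].
apply: runs_weaken (runs_max_fold (C := C) nT d2T (F := fun i => - ch i 0)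
    (g := fun i => tneg C (ch i 0)) (b := W (dot_bits T) + W (dot_bits T)) _ _) _ _ => //.
- by move=> i; rewrite heightN; apply: up.
- move=> d i dT; apply: runs_bind0 (runs_neg (up _ (cT i))) _ => _ ->.
  by apply: runs_max; rewrite // heightN; apply: up.
move=> d3 [d23 cd3 d3lt d3T]; have d13 := le_trans d12 d23.
rewrite sE sub0r normrN in d0E; split=> //; split=> //.
- by move=> j; apply: le_trans (bd1 j) d13.
- by move=> i; apply: le_trans (ld2 i) d23.
- by rewrite -d0E (le_trans d01).
- by move=> e be le ce se; apply: d3lt => //; apply: d2lt => //; apply: d1lt; rewrite // d0E.
Qed.

Definition system_size T : nat := T * (T * (2 * T + 4)) + T * (1 * (2 * T + 4)).

Lemma runs_solve T m k (M : 'M[rat]_(m, k)) (r : 'cV[rat]_m) :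
  row_free M -> row_full M -> (k <= T)%N -> (m <= T)%N ->
  (forall i j, height T (M i j)) -> (forall i, height T (r i 0)) ->
  runs (tsolve S M r) 0 (V (system_size T))
    (fun z => M *m z = r /\ forall i, height (cramer_bits T) (z i 0)).
Proof.
move=> Mfree Mfull kT mT MT rT; split=> //=.
  apply: SV => //; apply: leq_add.
    by apply: leq_trans (mx_size_le MT) _; rewrite leq_mul // leq_mul.
  apply: leq_trans (mx_size_le (N := T) _) _; last by rewrite leq_mul.
  by move=> i j; rewrite (ord1 j).
by split; [exact: SP | apply: (height_solution Mfree Mfull kT MT rT); exact: SP].
Qed.

Definition basic_primal_cost T : nat :=
  T * dot_cost T + (T * (T * W T) + (V (system_size (dot_bits T)) + T * W (basic_bits T))).

Lemma runs_basic_primal T m n (L : lp m n) B :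
  lp_bounded T L -> is_basis (lpA L) B ->
  runs (tbasic_primal C S L B) 0 (basic_primal_cost T)
    (fun x => basis_compatible L B x /\ forall i, height (basic_bits T) (x i 0)).
Proof.
case=> mT nT AT bT lT cT Bb; have up q : height T q -> height (dot_bits T) q.
  exact/height_mono/dot_bits_ge.
have BT : (#|B| <= T)%N by apply: leq_trans nT; rewrite -[n in leqRHS]card_ord max_card.
apply: runs_bind0 (runs_col mT (fun j => runs_subdot_skip (mem B) nT (bT j) (AT j) lT)) _ => r rP.
apply: runs_bind0.
  exact: (runs_mat mT BT (fun j k => runs_move (AT j (enum_val k)))).
move=> M MP.
have ME : M = basis_cols (lpA L) B by apply/matrixP=> j k; rewrite MP mxE.
have [Mfree Mfull] := basis_mx_free Bb; rewrite -ME in Mfree Mfull.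
apply: runs_bind0.
  apply: (runs_solve Mfree Mfull (leq_trans BT (dot_bits_ge T)) (leq_trans mT (dot_bits_ge T))).
    by move=> j k; rewrite MP; apply: up.
  by move=> j; case: (rP j).
move=> z [Mz zT].
pose X (i : 'I_n) : rat := if [pick k : 'I_#|B| | enum_val k == i] is Some k then z k 0
  else lpl L i 0.
have XT i : height (basic_bits T) (X i).
  by rewrite /X; case: pickP => [k _|_] //; apply: height_mono (basic_bits_ge T).2 _.
apply: runs_weaken (runs_col (b := W (basic_bits T)) (Q := fun i v => v = X i) nT _) _ _ => //.
  move=> i; move: (XT i); rewrite /X; case: pickP => [k _|_] ?; exact: runs_move.
move=> x xX; split; last by move=> i; rewrite xX.
have xN i : i \notin B -> x i 0 = lpl L i 0.
  by rewrite xX /X => /negP iB; case: pickP => [k /eqP ki|//]; case: iB; rewrite -ki enum_valP.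
split=> //; apply/colP=> j; rewrite (sum_basis _ B) -ME.
have -> : \col_k x (enum_val k) 0 = z.
  apply/colP=> k; rewrite mxE xX /X; case: pickP => [k' /eqP/enum_val_inj -> //|/(_ k)].
  by rewrite eqxx.
rewrite Mz; case: (rP j) => -> _.
(* Adding back the nonbasic terms subtracted in r recovers b. *)
rewrite -[RHS](subrK (\sum_(i | i \notin B) lpA L j i * lpl L i 0)).
by congr (_ + _); apply: eq_bigr => i /xN ->.
Qed.

Definition basic_dual_cost T : nat := T * (T * W T) + (T * W T + V (system_size T)).

Lemma runs_basic_dual T m n (L : lp m n) B :
  lp_bounded T L -> is_basis (lpA L) B ->
  runs (tbasic_dual C S L B) 0 (basic_dual_cost T)
    (fun y => (forall i, i \in B -> reduced_cost L y i 0 = 0) /\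
       forall j, height (cramer_bits T) (y j 0)).
Proof.
case=> mT nT AT bT lT cT Bb.
have BT : (#|B| <= T)%N by apply: leq_trans nT; rewrite -[n in leqRHS]card_ord max_card.
apply: runs_bind0.
  exact: (runs_mat BT mT (fun k j => runs_move (AT j (enum_val k)))).
move=> M MP.
have ME : M = (basis_cols (lpA L) B)^T by apply/matrixP=> k j; rewrite MP !mxE.
have [Mfree Mfull] := basis_mx_free Bb.
have [MTfree MTfull] : row_free M /\ row_full M.
  by rewrite ME /row_free /row_full !mxrank_tr.
apply: runs_bind0.
  exact: (runs_col BT (fun k => runs_move (cT (enum_val k)))).
move=> r rP; apply: runs_weaken (runs_solve MTfree MTfull mT BT _ _) _ _ => //.
- by move=> k j; rewrite MP.
- by move=> k; rewrite rP.
move=> y [My yT]; split=> // i iB.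
have := congr1 (fun w : 'cV[rat]_#|B| => w (enum_rank_in iB i) 0) My.
rewrite /= rP mxE; under eq_bigr do rewrite MP enum_rankK_in //.
rewrite enum_rankK_in // !mxE => <-; apply/eqP; rewrite subr_eq0; apply/eqP.
by apply: eq_bigr => j _; rewrite mxE.
Qed.

Definition primal_feasible_cost T : nat :=
  residual_cost T + (T * W (dot_bits T) + (T * W T + 0)).

Lemma runs_primal_feasible T m n (L : lp m n) (x : 'cV[rat]_n) :
  lp_bounded T L -> (forall i, height T (x i 0)) ->
  runs (tprimal_feasible C L x) 0 (primal_feasible_cost T)
    (fun v => v <-> primal_feasible L x).
Proof.
move=> LT xT; have [mT nT AT bT lT cT] := LT.
apply: runs_bind0 (runs_primal_residual LT xT) _ => r [rE rT].
apply: runs_bind0.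
  exact: (runs_forall mT (fun j => runs_eq (rT j) (height0 _))).
move=> _ ->; apply: runs_bind0.
  exact: (runs_forall nT (fun i => runs_le (lT i) (xT i))).
move=> _ ->; apply: runs_ret; split.
  case/andP=> /forallP r0 /forallP lx; split=> //; apply/eqP.
  rewrite -subr_eq0 -opprB -rE oppr_eq0; apply/eqP/colP=> j.
  by rewrite (eqP (r0 j)) mxE.
case=> Ax lx; apply/andP; split; apply/forallP=> // j.
by rewrite rE Ax subrr mxE.
Qed.

Definition dual_feasible_cost T : nat := residual_cost T + T * W (dot_bits T).

Lemma runs_dual_feasible T m n (L : lp m n) (y : 'cV[rat]_m) :
  lp_bounded T L -> (forall j, height T (y j 0)) ->
  runs (tdual_feasible C L y) 0 (dual_feasible_cost T)
    (fun v => v <-> dual_feasible L y).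
Proof.
move=> LT yT; have [mT nT AT bT lT cT] := LT.
apply: runs_bind0 (runs_dual_residual LT yT) _ => r [rE rT].
apply: runs_weaken (runs_forall nT (fun i => runs_le (height0 _) (rT i))) _ _ => // _ ->.
by rewrite rE; split=> [/forallP|/forallP].
Qed.

(** * Oracle calls *)

(** The size bound for a number of height 2p: rounded entries have constant size, so queries and
    answers are charged by dimension only. *)
Definition fixed_size : nat := 4 * p + 4.

Definition call_cost T : nat :=
  T * (T * W T) + (T * W T + (T * W T + (T * W T +
    (T * (T * fixed_size) + 3 * (T * fixed_size) + (2 * (T * fixed_size) + T).+1)))).

Lemma runs_call (R : realType) (eta sigma : R) (O : lp_oracle) T m n (L : lp m n) :
  lp_bounded T L ->
  (forall a, O m n (round_lp p L) = Some a -> good_answer p eta sigma L a) ->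
  runs (tcall C p O L) 1 (call_cost T) (fun o => o = O m n (round_lp p L)).
Proof.
case=> mT nT AT bT lT cT Ogood.
apply: runs_bind0 (runs_mat mT nT (fun i j => runs_round (AT i j))) _ => A AP.
apply: runs_bind0 (runs_col mT (fun j => runs_round (bT j))) _ => b bP.
apply: runs_bind0 (runs_col nT (fun i => runs_round (lT i))) _ => l lP.
apply: runs_bind0 (runs_col nT (fun i => runs_round (cT i))) _ => c cP.
have fixedE : (2 * (2 * p) + 4 = fixed_size)%N by rewrite /fixed_size; lia.
have three y : (3 * y = y + (y + y))%N by lia.
have two y : (2 * y = y + y)%N by lia.
have col_size k (v : 'cV[rat]_k) : (k <= T)%N -> (forall i, height (2 * p) (v i 0)) ->
    (mx_size v <= T * fixed_size)%N.
  move=> kT vT; apply: leq_trans (mx_size_le (N := 2 * p) _) _.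
    by move=> i j; rewrite (ord1 j).
  by rewrite mul1n fixedE leq_mul.
have QE : LP A b l c = round_lp p L.
  by congr LP; apply/matrixP=> i j; rewrite ?mxE ?(ord1 j) ?AP ?bP ?lP ?cP.
split=> //=; last by rewrite QE.
apply: leq_add; rewrite /lp_size /=.
  rewrite -!addnA; apply: leq_add.
    apply: leq_trans (mx_size_le (N := 2 * p) _) _.
      by move=> i j; rewrite AP height_round.
    by rewrite fixedE leq_mul // leq_mul.
  rewrite three; apply: leq_add; [|apply: leq_add]; rewrite col_size // => i;
    rewrite ?bP ?lP ?cP height_round //.
rewrite QE; case E: (O _ _ _) => [a|] //; have [xF yF _ _ _ _ _ _ _] := Ogood _ E.
rewrite /ans_size two leqW // leq_add // leq_add // col_size // => i; exact: in_fixed_height.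
Qed.

(** * Refinement steps, iterations and runs *)

(** Covers every operand of a refinement: the new scaling factor has height 2T since e' <= e +
    alpha, scaled data 3T, and answers divided by the factor 2p + 2T. *)
Definition refine_bits T : nat := 4 * T + 2 * p + 4.

Definition refine_cost T : nat :=
  let U := refine_bits T in
  W U + (W U + (W U + (W U + (W U + (T * W U + (T * W U + (T * W U +
  (call_cost U + (T * (W U + W U) + (T * (W U + W U) + 0)))))))))).

Lemma runs_refine (R : realType) (eta sigma : R) (O : lp_oracle) T m n (L : lp m n)
    (s : state m n) (bh : 'cV[rat]_m) (lh ch : 'cV[rat]_n) (d : rat) e :
  limited_precision_basis_oracle p eta sigma O -> row_free (lpA L) ->
  (2 <= alpha)%N -> (alpha <= T)%N -> (e <= T)%N -> st_D s = 2 ^+ e ->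
  0 < d < 2 ^- e -> height T d -> lp_bounded T (LP (lpA L) bh lh ch) ->
  (forall i, height T (st_x s i 0)) -> (forall j, height T (st_y s j 0)) ->
  runs (ir_refine C p alpha O L s bh lh ch d) 1 (refine_cost T)
    (fun o => o = Aborted m n \/ exists (e' : nat) (a : answer m n),
       [/\ (e < e')%N, (e' <= e + alpha)%N,
           good_answer p eta sigma (refined_lp L (2 ^+ e') bh lh ch) a &
           o = Running (State (st_x s + 2 ^- e' *: ansx a) (st_y s + 2 ^- e' *: ansy a)
                 (ansB a) (2 ^+ e'))]).
Proof.
move=> OP Afree a2 aT eT sD dP dT [mT nT AT bT lT cT] xT yT.
have powT k f : (f <= k)%N -> height k (2 ^+ f).
  by move=> fk; rewrite -natrX; apply: height_nat; rewrite leq_pexp2l.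
set U := refine_bits T.
have up k q : (k <= 4 * T + 2 * p + 4)%N -> height k q -> height U q by exact: height_mono.
have alphaT : height T alpha%:R.
  by apply: height_nat; rewrite (leq_trans aT) // ltnW // ltn_expl.
have DT : height T (st_D s) by rewrite sD powT.
apply: runs_bind0 (runs_mul (N := U) _ _) _; [by apply: up alphaT; clear; lia|
  by apply: up DT; clear; lia|].
move=> aD aDE; have aDT : height (2 * T) aD.
  by rewrite aDE mul2n -addnn; apply: heightM.
apply: runs_bind0 (runs_div (N := U) (height1 _) _) _; first by apply: up aDT; clear; lia.
move=> f fE; have fT : height (2 * T) f.
  by rewrite fE -[(2 * T)%N]add0n; apply/height_div/aDT/height1.
apply: runs_bind0 (runs_max (N := U) _ _) _; [by apply: up dT; clear; lia|
  by apply: up fT; clear; lia|].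
move=> d' d'E; have d'T : height (2 * T) d'.
  by rewrite d'E height_max //; apply: height_mono dT; clear; lia.
apply: runs_bind0 (runs_div (N := U) (height1 _) _) _; first by apply: up d'T; clear; lia.
move=> q qE; have qT : height (2 * T) q.
  by rewrite qE -[(2 * T)%N]add0n; apply/height_div/d'T/height1.
apply: runs_bind0 (runs_pow2 (N := U) _) _; first by apply: up qT; clear; lia.
move=> D DE; have [e' [D'E ee' e'e]] := pow2_ceil_refine a2 dP.
rewrite {}DE {}qE {}d'E {}fE {}aDE sD D'E in d'T qT aDT fT *.
have e'T : (e' <= 2 * T)%N by clear -e'e aT eT; lia.
have D'T : height (2 * T) (2 ^+ e') by apply: powT.
have scale_runs k (v : 'cV[rat]_k) : (k <= T)%N -> (forall i, height T (v i 0)) ->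
    runs (tcol (fun i => tmul C (2 ^+ e') (v i 0))) 0 (T * W U) (fun w => w = 2 ^+ e' *: v).
  move=> kT vT.
  apply: runs_weaken (runs_col (b := W U) (Q := fun i u => u = 2 ^+ e' * v i 0) kT _) _ _ => //.
  - by move=> i; apply: runs_mul; [apply: up D'T|apply: up (vT i)]; clear; lia.
  - by move=> w wE; apply/colP=> i; rewrite wE mxE.
apply: runs_bind0 (scale_runs _ _ mT bT) _ => _ ->.
apply: runs_bind0 (scale_runs _ _ nT lT) _ => _ ->.
apply: runs_bind0 (scale_runs _ _ nT cT) _ => _ ->.
have TU : (T <= U)%N by rewrite /U /refine_bits; clear; lia.
have scale_height k (v : 'cV[rat]_k) i : height T (v i 0) -> height U ((2 ^+ e' *: v) i 0).
  by move=> vT; rewrite mxE; apply: up (heightM D'T vT); clear; lia.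
have LT' : lp_bounded U (refined_lp L (2 ^+ e') bh lh ch).
  split=> /=; rewrite ?(leq_trans _ TU) //.
  - by move=> i j; apply: height_mono TU (AT i j).
  - by move=> j; apply/scale_height/bT.
  - by move=> j; apply/scale_height/lT.
  - by move=> j; apply/scale_height/cT.
have Lgood a : O m n (round_lp p (refined_lp L (2 ^+ e') bh lh ch)) = Some a ->
    good_answer p eta sigma (refined_lp L (2 ^+ e') bh lh ch) a.
  exact: OP.
apply: (runs_bind (c := 1) (c' := 0) (runs_call LT' Lgood)) => oa oaE.
case: oa oaE => [a /esym /Lgood ag|_]; last by split=> //; left.
have upd_runs k (v w : 'cV[rat]_k) : (k <= T)%N -> (forall i, height T (v i 0)) ->
    (forall i, in_fixed p (w i 0)) ->
    runs (tcol (fun i => let! t := tdiv C (w i 0) (2 ^+ e') in tadd C (v i 0) t)) 0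
      (T * (W U + W U)) (fun u => u = v + 2 ^- e' *: w).
  move=> kT vT wp.
  apply: runs_weaken (runs_col (b := W U + W U)
    (Q := fun i u => u = v i 0 + w i 0 / 2 ^+ e') kT _) _ _ => //.
  - move=> i; have wT := in_fixed_height (wp i).
    apply: runs_bind0 (runs_div (N := U) _ _) _; [by apply: up wT; clear; lia|
      by apply: up D'T; clear; lia|].
    move=> _ ->; apply: runs_add; first by apply: up (vT i); clear; lia.
    by apply: up (height_div wT D'T); clear; lia.
  - by move=> u uE; apply/colP=> i; rewrite uE !mxE [w i 0 / _]mulrC.
apply: runs_bind0 (upd_runs _ _ _ nT xT (ga_x_fixed ag)) _ => _ ->.
apply: runs_bind0 (upd_runs _ _ _ mT yT (ga_y_fixed ag)) _ => _ ->.
by apply: runs_ret; right; exists e', a.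
Qed.
(** Verification involves only the input and is charged at T0; residuals and refinement involve the
    iterates and are charged at T. *)
Definition iterate_cost (T0 T : nat) : nat :=
  residual_cost T + (T * W T + (residual_cost T + (violation_cost (dot_bits T) +
  (W (dot_bits (dot_bits T)) + (basic_primal_cost T0 + (basic_dual_cost T0 +
  (primal_feasible_cost (basic_bits T0) + (dual_feasible_cost (cramer_bits T0) +
   refine_cost (dot_bits (dot_bits T)))))))))).

Lemma runs_iterate (R : realType) (eta sigma : R) (O : lp_oracle) T0 T m n (L : lp m n) N e
    (s : state m n) :
  eta < 1 -> sigma < 1 -> (2 <= alpha)%N ->
  limited_precision_basis_oracle p eta sigma O -> row_free (lpA L) ->
  lp_bounded T0 L -> (T0 <= T)%N -> (alpha <= T)%N -> (2 * p + e + N.+1 <= T)%N ->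
  state_inv p alpha L N e s ->
  runs (ir_iterate C S p alpha O L s) 1 (iterate_cost T0 T)
    (fun o => match o with
     | Running s' => (e < verify_bits T0)%N /\ exists e', state_inv p alpha L N.+1 e' s'
     | Returned x y => optimal_pair L x y
     | Aborted => True
     end).
Proof.
move=> eta1 sigma1 a2 OP Afree LT0 T0T aT eNT [sD Ne eN sclose sx sy].
have LT := lp_bounded_mono T0T LT0; have [mT nT AT bT lT cT] := LT.
have xT i : height T (st_x s i 0) by apply: height_mono eNT (on_grid_height (sx i)).
have yT j : height T (st_y s j 0) by apply: height_mono eNT (on_grid_height (sy j)).
have ret1 T' (x : T') b (Q : T' -> Prop) : Q x -> runs (tret x) 1 b Q.
  by move=> Qx; apply: runs_weaken (runs_ret 1 Qx) (leq0n _) _.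
set T1 := dot_bits T; set T2 := dot_bits T1.
have TT1 : (T <= T1)%N := dot_bits_ge T; have T12 : (T1 <= T2)%N := dot_bits_ge T1.
have TT2 : (T <= T2)%N := leq_trans TT1 T12.
apply: runs_bind0 (runs_primal_residual LT xT) _ => bh [bhE bhT].
apply: (runs_bind0 (b := T * W T) (Q := fun v => v = lpl L - st_x s)).
  apply: runs_weaken (runs_col nT (fun i => runs_sub (lT i) (xT i))) _ _ => // v vE.
  by apply/colP=> i; rewrite vE !mxE.
move=> lh lhE; have lhT i : height T1 (lh i 0).
  rewrite lhE !mxE; apply: height_mono (heightB (lT i) (xT i)).
  by rewrite /T1 /dot_bits; clear; nia.
apply: runs_bind0 (runs_dual_residual LT yT) _ => ch [chE chT].
have mT1 := leq_trans mT TT1; have nT1 := leq_trans nT TT1.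
apply: runs_bind0 (runs_violation mT1 nT1 bhT lhT chT) _ => d [dP dT].
have dP' := dP; rewrite bhE lhE chE in dP'.
apply: runs_bind0 (runs_le dT (height0 _)) _ => _ ->.
case: (leP d 0) => [d0|d0]; first by apply: ret1; apply: violation_optimal dP' d0.
have Bb := cp_basis sclose.
apply: runs_bind0 (runs_basic_primal LT0 Bb) _ => x [xB xT0].
apply: runs_bind0 (runs_basic_dual LT0 Bb) _ => y [yB yT0].
apply: runs_bind0 (runs_primal_feasible (lp_bounded_mono (basic_bits_ge T0).2 LT0) xT0) _.
move=> px pxP.
apply: runs_bind0 (runs_dual_feasible (lp_bounded_mono (cramer_bits_ge T0) LT0) yT0) _.
move=> dy dyP; case: ifPn => [/andP[/pxP xF /dyP yF]|notF].
  apply: ret1; apply: optimal_pairP => //; rewrite big1 // => i _.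
  case: (boolP (i \in st_B s)) => iB; first by rewrite yB // mulr0.
  by case: xB => _ ->; rewrite // subrr mul0r.
(* A failed verification is informative: it bounds e, and this is the only source of termination. *)
have eV : (e < verify_bits T0)%N.
  rewrite ltnNge; apply: contra notF => Ve; apply/andP; split.
    exact/pxP/(basis_primal_verified LT0 sclose xB xT0 Ve).
  exact/dyP/(basis_dual_verified LT0 sclose yB yT0 Ve).
have dlt : 0 < d < 2 ^- e by rewrite d0 (violation_lt sclose dP').
have refT : lp_bounded T2 (LP (lpA L) bh lh ch).
  split=> /=; rewrite ?(leq_trans _ TT2) // => i.
  - by move=> j; apply: height_mono TT2 (AT i j).
  - exact: height_mono T12 (bhT i).
  - exact: height_mono T12 (lhT i).
  - exact: height_mono T12 (chT i).
have eT : (e <= T)%N by clear -eNT; lia.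
apply: runs_weaken (runs_refine (d := d) (e := e) OP Afree a2 (leq_trans aT TT2)
  (leq_trans eT TT2) sD dlt dT refT _ _) (leqnn _) _.
- by move=> i; apply: height_mono TT2 (xT i).
- by move=> j; apply: height_mono TT2 (yT j).
move=> _ [->|[e' [a [ee' e'e ga ->]]]] //; split=> //; exists e'; split=> //=.
- by clear -ee' Ne; lia.
- by rewrite mulSn; clear -e'e eN; lia.
- by rewrite bhE lhE chE in ga; apply: good_answer_close ga.
- by move=> i; rewrite !mxE; apply: on_grid_step (ltnW ee') (sx i) (ga_x_fixed ga i).
- by move=> j; rewrite !mxE; apply: on_grid_step (ltnW ee') (sy j) (ga_y_fixed ga j).
Qed.

Lemma runs_start (R : realType) (eta sigma : R) (O : lp_oracle) T0 m n (L : lp m n) :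
  eta < 1 -> sigma < 1 -> limited_precision_basis_oracle p eta sigma O ->
  row_free (lpA L) -> lp_bounded T0 L ->
  runs (ir_start C p O L) 1 (call_cost T0)
    (fun o => match o with
     | Running s => state_inv p alpha L 0 0 s
     | Returned x y => False
     | Aborted => True
     end).
Proof.
move=> eta1 sigma1 OP Afree LT; have Ogood := OP _ _ _ Afree.
rewrite -[call_cost T0]addn0; apply: (runs_bind (c := 1) (c' := 0) (runs_call LT Ogood)) => oa oaE.
case: oa oaE => [a /esym /Ogood ga|_]; last exact: runs_ret.
(* The initial call is treated as a refinement of the zero pair with scaling factor 1. *)
have LE : L = refined_lp L (2 ^+ 0) (lpb L - lpA L *m 0) (lpl L - 0) (reduced_cost L 0).
  by clear; case: L => *; rewrite /refined_lp /reduced_cost /= !mulmx0 !subr0 !scale1r.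
have := ga; rewrite {1}LE => /(good_answer_close eta1 sigma1).
rewrite expr0 invr1 !scale1r !add0r => aclose.
apply: runs_ret; split=> //= i.
- have := on_grid_step (leqnn 0) (on_grid0 p 0) (ga_x_fixed ga i).
  by rewrite expr0 invr1 mul1r add0r.
- have := on_grid_step (leqnn 0) (on_grid0 p 0) (ga_y_fixed ga i).
  by rewrite expr0 invr1 mul1r add0r.
Qed.

(** The last bracket bounds 2p + e + N + 1 by means of e <= N alpha and N <= [verify_bits T0]. *)
Definition state_bits T0 : nat :=
  T0 + alpha + (2 * p + verify_bits T0 * alpha + (verify_bits T0).+1).

Lemma runs_ir_run (R : realType) (eta sigma : R) (O : lp_oracle) T0 m n (L : lp m n) N :
  eta < 1 -> sigma < 1 -> (2 <= alpha)%N ->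
  limited_precision_basis_oracle p eta sigma O -> row_free (lpA L) -> lp_bounded T0 L ->
  runs (ir_run C S p alpha O L N) N.+1
    (call_cost T0 + N * iterate_cost T0 (state_bits T0))
    (fun o => match o with
     | Running s => (N <= verify_bits T0)%N /\ exists e, state_inv p alpha L N e s
     | Returned x y => optimal_pair L x y
     | Aborted => True
     end).
Proof.
move=> eta1 sigma1 a2 OP Afree LT; elim: N => [|N IH].
  apply: runs_weaken (runs_start eta1 sigma1 OP Afree LT) _ _; first exact: leq_addr.
  by case=> // s sI; split=> //; exists 0%N.
rewrite mulSn addnC -addnA [(N * _ + _)%N]addnC addnC -[N.+2]addn1.
apply: runs_bind IH _ => -[s [NV [e sI]]|x y xy|] //.
apply: runs_weaken (runs_iterate eta1 sigma1 a2 OP Afree LT _ _ _ sI) (leqnn _) _.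
- by rewrite /state_bits -addnA leq_addr.
- by rewrite /state_bits addnAC leq_addl.
- rewrite /state_bits (leq_trans _ (leq_addl _ _)) // !leq_add // (leq_trans (si_le sI)) //.
  by rewrite leq_mul.
case=> // s' [eV [e' sI']]; split; last by exists e'.
(* N <= e and e < [verify_bits T0], so even N + 1 stays within the bound. *)
exact: leq_ltn_trans (si_ge sI) eV.
Qed.
End Costs.

(** * Polynomiality of the cost functions *)

(** Over [nat] a sum of polynomials dominates each summand, so finitely many bounds merge into
    one. *)
Lemma uniform_poly_bound (I X : Type) (f : I -> X -> nat) (g : X -> nat) (s : seq I) :
  (forall i, exists P : {poly nat}, forall x, (f i x <= P.[g x])%N) ->
  exists P : {poly nat}, forall i x, List.In i s -> (f i x <= P.[g x])%N.
Proof.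
move=> fP; elim: s => [|i s [P sP]]; first by exists 0.
have [Q iQ] := fP i; exists (Q + P) => j x; rewrite hornerD => -[<-|/sP js].
  exact: leq_trans (iQ x) (leq_addr _ _).
exact: leq_trans (js x) (leq_addl _ _).
Qed.

Lemma polyb_cost_bound p (C : bit_cost) : polynomial_bit_cost C ->
  exists W : nat -> nat, [/\ polyb W,
    forall o N x, List.In o [:: Move; Neg; Abs; Round p; Pow2Ceil] ->
      height N x -> (cost1 C o x <= W N)%N &
    forall o N x y, height N x -> height N y -> (cost2 C o x y <= W N)%N].
Proof.
case=> C1 C2.
have [P PP] := uniform_poly_bound [:: Move; Neg; Abs; Round p; Pow2Ceil] C1.
have [|Q QP] := @uniform_poly_bound _ (rat * rat) (fun o u => cost2 C o u.1 u.2)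
    (fun u => rat_size u.1 + rat_size u.2)%N [:: Add; Defs.Sub; Mul; Div; Cmp] _.
  by move=> o; have [Q QP] := C2 o; exists Q => u; apply: QP.
pose sz N := (2 * N + 4)%N.
have sz_polyb : polyb sz.
  by apply: polybD (polyb_cst _); apply: polybM (polyb_cst _) polyb_id.
exists (fun N => P.[sz N] + Q.[sz N + sz N])%N; split.
- apply: polybD; first exact: polyb_comp (polyb_horner P) sz_polyb.
  exact: polyb_comp (polyb_horner Q) (polybD sz_polyb sz_polyb).
- move=> o N x os /rat_size_le xN; apply: leq_trans (PP o x os) _.
  exact: leq_trans (horner_nat_mono P xN) (leq_addr _ _).
- move=> o N x y /rat_size_le xN /rat_size_le yN.
  have os : List.In o [:: Add; Defs.Sub; Mul; Div; Cmp] by case: o => /=; tauto.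
  apply: leq_trans (QP o (x, y) os) _.
  exact: leq_trans (horner_nat_mono Q (leq_add xN yN)) (leq_addl _ _).
Qed.

Ltac polyb_step := first [exact: polyb_id | assumption | apply: polyb_cst
  | apply: polybD | apply: polybM | apply: polybS].

Lemma polyb_dot_bits : polyb dot_bits.
Proof. by rewrite /dot_bits; repeat polyb_step. Qed.

Lemma polyb_cramer_bits : polyb cramer_bits.
Proof. by rewrite /cramer_bits /entry_bits; repeat polyb_step. Qed.

Lemma polyb_basic_bits : polyb basic_bits.
Proof. exact: polyb_comp polyb_cramer_bits polyb_dot_bits. Qed.

Lemma polyb_verify_bits : polyb verify_bits.
Proof.
rewrite /verify_bits; have db := polyb_dot_bits; have cb := polyb_cramer_bits.
have bb := polyb_basic_bits; have dcb := polyb_comp db cb.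
by repeat polyb_step.
Qed.

Lemma polyb_state_bits p alpha : polyb (state_bits p alpha).
Proof. by rewrite /state_bits; have vb := polyb_verify_bits; repeat polyb_step. Qed.

Section PolynomialCost.

Variables (p alpha : nat) (W V : nat -> nat).
Hypotheses (Wp : polyb W) (Vp : polyb V).

Lemma polyb_call_cost : polyb (call_cost p W).
Proof. by rewrite /call_cost; repeat polyb_step. Qed.

Lemma polyb_iterate_cost : polyb (fun s => iterate_cost p W V s (state_bits p alpha s)).
Proof.
have db := polyb_dot_bits; have cb := polyb_cramer_bits; have bb := polyb_basic_bits.
have Wd := polyb_comp Wp db.
have dot : polyb (dot_cost W) by rewrite /dot_cost; repeat polyb_step.
have res : polyb (residual_cost W) by rewrite /residual_cost; repeat polyb_step.
have vio : polyb (violation_cost W) by rewrite /violation_cost; repeat polyb_step.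
have sys : polyb system_size by rewrite /system_size; repeat polyb_step.
have Vs := polyb_comp Vp sys; have Vsd := polyb_comp Vs db; have Wb := polyb_comp Wp bb.
have bpr : polyb (basic_primal_cost W V) by rewrite /basic_primal_cost; repeat polyb_step.
have bdu : polyb (basic_dual_cost W V) by rewrite /basic_dual_cost; repeat polyb_step.
have pfe : polyb (primal_feasible_cost W) by rewrite /primal_feasible_cost; repeat polyb_step.
have dfe : polyb (dual_feasible_cost W) by rewrite /dual_feasible_cost; repeat polyb_step.
have rb : polyb (refine_bits p) by rewrite /refine_bits; repeat polyb_step.
have Wr := polyb_comp Wp rb; have Cr := polyb_comp polyb_call_cost rb.
have ref : polyb (refine_cost p W) by rewrite /refine_cost; repeat polyb_step.
have st := polyb_state_bits p alpha; have d1 := polyb_comp db st; have d2 := polyb_comp db d1.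
have W0 := polyb_comp Wp st; have W2 := polyb_comp Wp d2.
have res0 := polyb_comp res st; have vio1 := polyb_comp vio d1; have ref2 := polyb_comp ref d2.
have pfe0 := polyb_comp pfe bb; have dfe0 := polyb_comp dfe cb.
by rewrite /iterate_cost; repeat polyb_step.
Qed.

End PolynomialCost.

(** Every entry has positive size, so the sizes of b and l bound the dimensions m and n. *)
Lemma lp_size_bounded m n (L : lp m n) : lp_bounded (lp_size L) L.
Proof.
have [bs ls] : (mx_size (lpb L) <= lp_size L)%N /\ (mx_size (lpl L) <= lp_size L)%N.
  by rewrite /lp_size; lia.
have [As cs] : (mx_size (lpA L) <= lp_size L)%N /\ (mx_size (lpc L) <= lp_size L)%N.
  by rewrite /lp_size; lia.
have entry k l (M : 'M[rat]_(k, l)) i j : (mx_size M <= lp_size L)%N ->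
    height (lp_size L) (M i j).
  by move=> Ms; apply: height_mono (height_rat_size _); apply: leq_trans (rat_size_entry M i j) Ms.
split=> *; rewrite ?entry //.
- by apply: leq_trans bs; rewrite -[leqLHS]muln1 mx_size_ge.
- by apply: leq_trans ls; rewrite -[leqLHS]muln1 mx_size_ge.
Qed.

Theorem theorem5 (R : realType) (p alpha : nat) (eta sigma : R)
    (C : bit_cost) (S : lin_solver) :
  (2 <= alpha)%N -> 0 < eta < 1 -> 0 < sigma < 1 ->
  polynomial_bit_cost C -> polynomial_time_solver S ->
  exists P : {poly nat},
  forall (m n : nat) (L : lp m n) (O : lp_oracle),
    limited_precision_basis_oracle p eta sigma O ->
    (m <= n)%N -> row_free (lpA L) ->
    (exists x, primal_feasible L x) -> (exists y, dual_feasible L y) ->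
    (forall N, val_of (ir_run C S p alpha O L N) <> Aborted m n) ->
    exists (N : nat) (x : 'cV[rat]_n) (y : 'cV[rat]_m),
      [/\ val_of (ir_run C S p alpha O L N) = Returned x y,
          optimal_pair L x y,
          (calls_of (ir_run C S p alpha O L N) <= P.[lp_size L])%N &
          (bits_of (ir_run C S p alpha O L N) <= P.[lp_size L])%N].
Proof.
move=> a2 /andP[_ eta1] /andP[_ sigma1] /(polyb_cost_bound p) [W [Wp W1 W2]] [SP [PS SPS]].
pose V N := PS.[N]%N.
have SV m k (M : 'M[rat]_(m, k)) (r : 'cV[rat]_m) N : row_free M -> row_full M ->
    (mx_size M + mx_size r <= N)%N -> ((S m k M r).2 <= V N)%N.
  by move=> Mfree Mfull MN; apply: leq_trans (SPS _ _ M r Mfree Mfull) (horner_nat_mono PS MN).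
pose bound s := ((verify_bits s).+2 +
  (call_cost p W s + (verify_bits s).+1 * iterate_cost p W V s (state_bits p alpha s)))%N.
have [P boundP] : polyb bound.
  have vb := polyb_verify_bits; have cc := polyb_call_cost p Wp.
  have ic := polyb_iterate_cost p alpha Wp (polyb_horner PS : polyb V).
  by rewrite /bound; repeat polyb_step.
(* After one iteration more than [verify_bits], the invariant rules out a running state. *)
exists P => m n L O OP mn Afree _ _ noabort; exists (verify_bits (lp_size L)).+1.
have := runs_ir_run W1 W2 SP SV (verify_bits (lp_size L)).+1 eta1 sigma1 a2 OP Afree
  (lp_size_bounded L).
case=> calls bits; have := noabort (verify_bits (lp_size L)).+1.
case: (val_of _) => [s _ [VV _]|x y _ xy|//]; first by rewrite ltnn in VV.
exists x, y; split=> //; apply: leq_trans (boundP _).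
  exact: leq_trans calls (leq_addr _ _).
exact: leq_trans bits (leq_addl _ _).
Qed.
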